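(* Let $d\ge 1$ be an integer and let $p\in \mathbb{C}[x_1,\dots,x_d][t]$ have $t$-degree $n\ge 1$, i.e. $p=a_0+a_1t+\cdots+a_nt^n$ with $a_0,\dots,a_n\in\mathbb{C}[x_1,\dots,x_d]$, $a_n\neq 0$ and $n\geq 1$. Then the solution set $S_p=\{u\in C(\mathbb{R},\mathcal{D}'(\mathbb{R}^d)) : D_pT_u=0\}$ has the concatenability property if and only if $n=1$.
   Context: $\mathcal{D}(\mathbb{R}^m)$ is the space of complex-valued compactly supported $C^\infty$ test functions on $\mathbb{R}^m$, and $\mathcal{D}'(\mathbb{R}^m)$ is the space of complex-valued distributions on $\mathbb{R}^m$; $\langle T,\psi\rangle$ denotes the action of $T$ on $\psi$. For an open set $I\subset\mathbb{R}$, a function $u:I\to\mathcal{D}'(\mathbb{R}^d)$ is called locally integrable (respectively continuous, respectively $C^k$) if for every $\psi\in\mathcal{D}(\mathbb{R}^d)$ the scalar function $t\mapsto\langle u(t),\psi\rangle$, $I\to\mathbb{C}$, is locally integrable (respectively continuous, respectively $C^k$). The corresponding spaces are denoted $L^1_{\rm loc}(I,\mathcal{D}'(\mathbb{R}^d))$, $C(I,\mathcal{D}'(\mathbb{R}^d))$, $C^k(I,\mathcal{D}'(\mathbb{R}^d))$. $\mathcal{L}(\mathcal{D}(\mathbb{R}),\mathcal{D}'(\mathbb{R}^d))$ is the space of continuous linear maps from $\mathcal{D}(\mathbb{R})$ to $\mathcal{D}'(\mathbb{R}^d)$; the value of such a map $U$ at $\varphi$ is written $\langle U,\varphi\rangle\in\mathcal{D}'(\mathbb{R}^d)$.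 For $u\in L^1_{\rm loc}(\mathbb{R},\mathcal{D}'(\mathbb{R}^d))$, the corresponding regular distribution $T_u\in\mathcal{L}(\mathcal{D}(\mathbb{R}),\mathcal{D}'(\mathbb{R}^d))$ is defined by $\langle\langle T_u,\varphi\rangle,\psi\rangle=\int_{\mathbb{R}}\varphi(t)\langle u(t),\psi\rangle\,dt$ for all $\varphi\in\mathcal{D}(\mathbb{R})$, $\psi\in\mathcal{D}(\mathbb{R}^d)$. For $U\in\mathcal{L}(\mathcal{D}(\mathbb{R}),\mathcal{D}'(\mathbb{R}^d))$, the derivative $\frac{dU}{dt}$ is defined by $\langle\langle \frac{dU}{dt},\varphi\rangle,\psi\rangle=-\langle\langle U,\varphi'\rangle,\psi\rangle$. A constant-coefficient operator $a(\frac{\partial}{\partial x_1},\dots,\frac{\partial}{\partial x_d})$ acts on $U$ through its values: $\langle a(\frac{\partial}{\partial x_1},\dots,\frac{\partial}{\partial x_d})U,\varphi\rangle=a(\frac{\partial}{\partial x_1},\dots,\frac{\partial}{\partial x_d})\langle U,\varphi\rangle$, with distributional derivatives in $\mathcal{D}'(\mathbb{R}^d)$. For $p=a_0+a_1t+\cdots+a_nt^n$ with $a_k\in\mathbb{C}[x_1,\dots,x_d]$, the operator $D_p:\mathcal{L}(\mathcal{D}(\mathbb{R}),\mathcal{D}'(\mathbb{R}^d))\to\mathcal{L}(\mathcal{D}(\mathbb{R}),\mathcal{D}'(\mathbb{R}^d))$ is $D_pU=\sum_{k=0}^n a_k(\frac{\partial}{\partial x_1},\dots,\frac{\partial}{\partial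 x_d})\frac{d^kU}{dt^k}$. If $u_1,u_2\in S_p\cap C^1(\mathbb{R},\mathcal{D}'(\mathbb{R}^d))$ satisfy $u_1(0)=u_2(0)$ in $\mathcal{D}'(\mathbb{R}^d)$, their concatenation is the function in $C(\mathbb{R},\mathcal{D}'(\mathbb{R}^d))$ equal to $u_1(t)$ for $t\le 0$ and to $u_2(t)$ for $t\ge 0$. The set $S_p$ has the concatenability property if, whenever $u_1,u_2\in S_p\cap C^1(\mathbb{R},\mathcal{D}'(\mathbb{R}^d))$ and $u_1(0)=u_2(0)$, their concatenation belongs to $S_p$. *)

(* Defs.v *)
From HB Require Import structures.
From mathcomp Require Import all_boot all_order all_algebra.
From mathcomp Require Import all_classical all_reals all_analysis.
From mathcomp Require Import complex ring lra.
From mathcomp Require mpoly.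
Import -(notations) mpoly.

Set Implicit Arguments.
Unset Strict Implicit.
Unset Printing Implicit Defensive.
Import Order.TTheory GRing.Theory Num.Theory.
Import numFieldNormedType.Exports.
Local Open Scope classical_set_scope.
Local Open Scope ring_scope.

Notation normc := Normc.normc.

Section RealPart.
Context (R : realType).

Lemma derive_line (V : normedModType R) (f : V -> R) (x v : V) (t : R) :
  derivable f (x + t *: v) v ->
  is_derive t 1 (fun s : R => f (x + s *: v)) ('D_v f (x + t *: v)).
Proof.
rewrite /derivable /derive => df.
have E : (fun h : R => h^-1 *: (((fun s : R => f (x + s *: v)) \o shift t) (h *: (1 : R)) - f (x + t *: v)))
  = (fun h : R => h^-1 *: ((f \o shift (x + t *: v)) (h *: v) - f (x + t *: v))).
  apply/funext => h /=; congr (_ *: (f _ - _)).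
  by rewrite [h *: 1]mulr1 scalerDl addrCA.
by apply: DeriveDef; rewrite /derivable /derive E.
Qed.

Lemma deriv_bound (V : normedModType R) (f : V -> R) (v : V) (M : R) :
  (forall x, derivable f x v) -> (forall x, `|'D_v f x| <= M) ->
  forall x h, `|f (x + h *: v) - f x| <= M * `|h|.
Proof.
move=> df bf x h.
pose g (s : R) := f (x + s *: v).
have dg (t : R) : is_derive t 1 g ('D_v f (x + t *: v)) by exact: derive_line.
have cg a b : {within `[a, b], continuous g}.
  apply: continuous_subspaceT => t.
  apply: differentiable_continuous; apply/derivable1_diffP.
  by have [] := dg t.
have key a b : a <= b -> `|g b - g a| <= M * (b - a).
  move=> ab; have [c _ ->] := MVT_segment ab (fun t _ => dg t) (@cg a b).
  by rewrite normrM [ `|b - a|]ger0_norm ?subr_ge0// ler_wpM2r// subr_ge0.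
have g0 : f x = g 0 by rewrite /g scale0r addr0.
rewrite g0 -[f _]/(g h); have [h0|h0] := leP 0 h.
  by rewrite (ger0_norm h0) -{2}[h]subr0 key.
by rewrite distrC (ltr0_norm h0) -[- h]sub0r key// ltW.
Qed.

Lemma unif_limit_derive (V : normedModType R) (f : nat -> V -> R) (F G : V -> R) (v : V) :
  (forall n x, derivable (f n) x v) ->
  (forall x, f n x @[n --> \oo] --> F x) ->
  (forall eps, 0 < eps -> \forall n \near \oo, forall x, `|'D_v (f n) x - G x| <= eps) ->
  forall x, is_derive x v F (G x).
Proof.
move=> df cf cG x.
have key : (fun h => h^-1 *: ((F \o shift x) (h *: v) - F x)) @ 0^' --> G x.
  apply/cvgrPdist_le => e e0.
  have e4 : 0 < e / 4 by rewrite divr_gt0.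
  have [N _ HN] := cG _ e4.
  have near_quot : \forall h \near (0:R)^', `|'D_v (f N) x - h^-1 *: (f N (h *: v + x) - f N x)| <= e / 4.
    by have /cvgrPdist_le := df N x; apply.
  have hne : \forall h \near (0:R)^', h != 0 by exact: nbhs_dnbhs_neq.
  near=> h => /=.
  have h0 : h != 0 by near: h.
  have Hb n : (N <= n)%N ->
      `|(f n (x + h *: v) - f N (x + h *: v)) - (f n x - f N x)| <= e / 2 * `|h|.
    move=> Nn.
    have -> : (f n (x + h *: v) - f N (x + h *: v)) - (f n x - f N x) =
       (f n - f N) (x + h *: v) - (f n - f N) x by [].
    apply: deriv_bound => y; first exact: derivableB.
    rewrite deriveB//.
    have := HN n Nn y; have := HN N (leqnn N) y => /= H1 H2.
    rewrite (_ : _ - _ = ('D_v (f n) y - G y) - ('D_v (f N) y - G y)); last by ring.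
    apply: (le_trans (ler_normB _ _)); lra.
  have Hl : `|(F (x + h *: v) - f N (x + h *: v)) - (F x - f N x)| <= e / 2 * `|h|.
    have cv : `|(f n (x + h *: v) - f N (x + h *: v)) - (f n x - f N x)| @[n --> \oo] -->
       `|(F (x + h *: v) - f N (x + h *: v)) - (F x - f N x)|.
      by apply: cvg_norm; apply: cvgB; apply: cvgB => //; exact: cvg_cst.
    apply: (@closed_cvg _ _ _ _ _ (fun y => y <= e / 2 * `|h|) _ _ _ cv); first exact: closed_le.
    by exists N.
  have H1 : `|'D_v (f N) x - h^-1 *: (f N (h *: v + x) - f N x)| <= e / 4 by near: h.
  have H2 := HN N (leqnn N) x.
  have H3 : `|h^-1 *: (F (h *: v + x) - F x) - h^-1 *: (f N (h *: v + x) - f N x)| <= e / 2.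
    rewrite -scalerBr normrZ normfV -ler_pdivlMl ?invr_gt0 ?normr_gt0// invrK mulrC.
    rewrite [h *: v + x]addrC; apply: le_trans Hl.
    by rewrite le_eqVlt; apply/orP; left; apply/eqP; congr (`|_|); ring.
  set A := h^-1 *: (F _ - F x) in H3 *.
  set B := h^-1 *: (f N _ - _) in H1 H3.
  rewrite (_ : G x - A = - ('D_v (f N) x - G x) + ('D_v (f N) x - B) - (A - B)); last by ring.
  apply: (le_trans (ler_normB _ _)).
  have := ler_normD (- ('D_v (f N) x - G x)) ('D_v (f N) x - B).
  rewrite normrN; lra.
apply: DeriveDef; first by apply/cvg_ex; exists (G x).
exact: cvg_lim key.
Unshelve. all: by end_near. Qed.

End RealPart.

Section ComplexCalculus.
Context (R : realType).

(* R[i] carries no normed R-module structure, so complex-valued functions of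
   real variables are handled through their real and imaginary parts. *)
Definition ccontinuous (T : topologicalType) (f : T -> R[i]) : Prop :=
  continuous (fun x => complex.Re (f x)) /\
  continuous (fun x => complex.Im (f x)).

Definition cderivable (V : normedModType R) (f : V -> R[i]) (x v : V) : Prop :=
  derivable (fun y => complex.Re (f y)) x v /\
  derivable (fun y => complex.Im (f y)) x v.

Definition cderive (V : normedModType R) (v : V) (f : V -> R[i]) : V -> R[i] :=
  fun x => ('D_v (fun y => complex.Re (f y)) x +i*
            'D_v (fun y => complex.Im (f y)) x)%C.

Definition cintegral (f : R -> R[i]) : R[i] :=
  (\int[lebesgue_measure]_t complex.Re (f t) +i*
   \int[lebesgue_measure]_t complex.Im (f t))%C.

Lemma ReL (a x y : R[i]) : complex.Re (a * x + y) =
  complex.Re a * complex.Re x - complex.Im a * complex.Im x + complex.Re y.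
Proof. by case: a x y => [a b] [c d] [e f]. Qed.

Lemma ImL (a x y : R[i]) : complex.Im (a * x + y) =
  complex.Re a * complex.Im x + complex.Im a * complex.Re x + complex.Im y.
Proof. by case: a x y => [a b] [c d] [e f]. Qed.

Lemma normc_ge0 (x : R[i]) : 0 <= normc x.
Proof. by case: x => a b; exact: sqrtr_ge0. Qed.

Lemma normcD (x y : R[i]) : normc (x + y) <= normc x + normc y.
Proof. exact: le_normcD. Qed.

Lemma normcB (x y : R[i]) : normc (x - y) <= normc x + normc y.
Proof. by rewrite -(normcN y); exact: normcD. Qed.

Lemma normc_Re (x : R[i]) : `|complex.Re x| <= normc x.
Proof.
case: x => a b /=; rewrite -sqrtr_sqr ler_sqrt ?lerDl ?sqr_ge0//.
by rewrite addr_ge0 ?sqr_ge0.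
Qed.

Lemma normc_Im (x : R[i]) : `|complex.Im x| <= normc x.
Proof.
case: x => a b /=; rewrite -sqrtr_sqr ler_sqrt ?lerDr ?sqr_ge0//.
by rewrite addr_ge0 ?sqr_ge0.
Qed.

Lemma normc_le (x : R[i]) : normc x <= `|complex.Re x| + `|complex.Im x|.
Proof.
case: x => a b /=; have h : 0 <= `|a| + `|b| by rewrite addr_ge0.
rewrite -[leRHS](ger0_norm h) -sqrtr_sqr ler_sqrt ?sqr_ge0//.
rewrite sqrrD !real_normK ?num_real// -addrA lerD2l lerDr.
by rewrite mulrn_wge0// mulr_ge0.
Qed.

Lemma normc_real (a : R) : normc (a%:C)%C = `|a|.
Proof. by rewrite /= expr0n /= addr0 sqrtr_sqr. Qed.

Lemma normc_sum (I : Type) (r : seq I) (F : I -> R[i]) :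
  normc (\sum_(i <- r) F i) <= \sum_(i <- r) normc (F i).
Proof.
elim: r => [|i r ih]; first by rewrite !big_nil Normc.normc0.
by rewrite !big_cons (le_trans (normcD _ _))// lerD2l.
Qed.

Lemma cont_add (T : topologicalType) (f g : T -> R) :
  continuous f -> continuous g -> continuous (fun x => f x + g x).
Proof. by move=> cf cg x; apply: cvgD; [exact: cf|exact: cg]. Qed.

Lemma cont_sub (T : topologicalType) (f g : T -> R) :
  continuous f -> continuous g -> continuous (fun x => f x - g x).
Proof. by move=> cf cg x; apply: cvgB; [exact: cf|exact: cg]. Qed.

Lemma cont_mul (T : topologicalType) (f g : T -> R) :
  continuous f -> continuous g -> continuous (fun x => f x * g x).
Proof. by move=> cf cg x; apply: cvgM; [exact: cf|exact: cg]. Qed.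

Lemma ccontinuousM (T : topologicalType) (f g : T -> R[i]) :
  ccontinuous f -> ccontinuous g -> ccontinuous (fun x => f x * g x).
Proof.
move=> [f1 f2] [g1 g2]; split.
  rewrite (_ : (fun x => _) = (fun x => complex.Re (f x) * complex.Re (g x) -
    complex.Im (f x) * complex.Im (g x))); last first.
    by apply/funext => x; case: (f x) (g x) => [a b] [c d].
  by apply: cont_sub; apply: cont_mul.
rewrite (_ : (fun x => _) = (fun x => complex.Re (f x) * complex.Im (g x) +
    complex.Im (f x) * complex.Re (g x))); last first.
  by apply/funext => x; case: (f x) (g x) => [a b] [c d].
by apply: cont_add; apply: cont_mul.
Qed.

Lemma ccontinuous_cst (T : topologicalType) (a : R[i]) :
  ccontinuous (fun _ : T => a).
Proof. by split=> x; exact: cvg_cst. Qed.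

Lemma ccontinuousL (T : topologicalType) (a : R[i]) (f g : T -> R[i]) :
  ccontinuous f -> ccontinuous g -> ccontinuous (fun x => a * f x + g x).
Proof.
move=> cf [g1 g2]; have [h1 h2] := ccontinuousM (ccontinuous_cst T a) cf; split.
  rewrite (_ : (fun x => _) = (fun x => complex.Re (a * f x) + complex.Re (g x))).
    exact: cont_add.
  by apply/funext => x; case: (a * f x) (g x) => [b c] [d e].
rewrite (_ : (fun x => _) = (fun x => complex.Im (a * f x) + complex.Im (g x))).
  exact: cont_add.
by apply/funext => x; case: (a * f x) (g x) => [b c] [d e].
Qed.

Lemma normc_continuous (T : topologicalType) (f : T -> R[i]) :
  ccontinuous f -> continuous (fun x => normc (f x)).
Proof.
move=> [f1 f2]; rewrite (_ : (fun x => _) = (fun x => Num.sqrt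
   (complex.Re (f x) * complex.Re (f x) + complex.Im (f x) * complex.Im (f x)))).
  move=> x; apply: continuous_comp; last exact: sqrt_continuous.
  by move: x; apply: cont_add; apply: cont_mul.
by apply/funext => x; case: (f x).
Qed.

Section Derive.
Context (V : normedModType R).
Implicit Types (f g : V -> R[i]) (x v : V).

Lemma is_derive_comb (a b : R) (f g h : V -> R) (x v : V) :
  derivable f x v -> derivable g x v -> derivable h x v ->
  is_derive x v (fun y => a * f y + b * g y + h y)
    (a * 'D_v f x + b * 'D_v g x + 'D_v h x).
Proof.
move=> /derivableP df /derivableP dg /derivableP dh.
rewrite (_ : (fun y => _) = a *: f + b *: g + h)//.
exact: is_deriveD.
Qed.

Lemma cderiveL (a : R[i]) f g x v : cderivable f x v -> cderivable g x v ->
  cderivable (a *: f + g) x v /\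
  cderive v (a *: f + g) x = a * cderive v f x + cderive v g x.
Proof.
move=> [f1 f2] [g1 g2].
have H1 : is_derive x v (fun y => complex.Re ((a *: f + g) y))
   (complex.Re a * 'D_v (fun y => complex.Re (f y)) x + (- complex.Im a)
     * 'D_v (fun y => complex.Im (f y)) x + 'D_v (fun y => complex.Re (g y)) x).
  rewrite (_ : (fun y => _) = (fun y => complex.Re a * complex.Re (f y) +
    (- complex.Im a) * complex.Im (f y) + complex.Re (g y))); first exact: is_derive_comb.
  by apply/funext => y; rewrite mulNr -ReL.
have H2 : is_derive x v (fun y => complex.Im ((a *: f + g) y))
   (complex.Re a * 'D_v (fun y => complex.Im (f y)) x + complex.Im a
     * 'D_v (fun y => complex.Re (f y)) x + 'D_v (fun y => complex.Im (g y)) x).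
  rewrite (_ : (fun y => _) = (fun y => complex.Re a * complex.Im (f y) +
    complex.Im a * complex.Re (f y) + complex.Im (g y))); first exact: is_derive_comb.
  by apply/funext => y; rewrite -ImL.
split; first by split; [case: H1|case: H2].
rewrite /cderive (@derive_val _ _ _ _ _ _ _ H1) (@derive_val _ _ _ _ _ _ _ H2).
by apply/eqP; rewrite eq_complex ReL ImL /= mulNr !eqxx.
Qed.

Lemma cderive_near0 f x v : (\forall y \near x, f y = 0) -> cderive v f x = 0.
Proof.
move=> f0; rewrite /cderive.
rewrite (@near_eq_derive _ _ _ (fun y => complex.Re (f y)) (cst 0)); last first.
  by near=> y; rewrite (near f0 y).
rewrite (@near_eq_derive _ _ _ (fun y => complex.Im (f y)) (cst 0)); last first.
  by near=> y; rewrite (near f0 y).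
by rewrite !derive_cst.
Unshelve. all: by end_near. Qed.

End Derive.
End ComplexCalculus.

Section TestFunctions.
Context (R : realType) (m : nat).
Local Notation V := 'rV[R]_m.
Implicit Types (f g : V -> R[i]) (w : seq 'I_m).

(* pderiv [:: i1; ...; ik] f is d/dx_i1 ... d/dx_ik f. *)
Definition pderiv w f : V -> R[i] :=
  foldr (fun i g => cderive (delta_mx 0 i) g) f w.

Definition smooth f : Prop := forall w, ccontinuous (pderiv w f) /\
  forall i x, cderivable (pderiv w f) x (delta_mx 0 i).

Definition test_pred : {pred V -> R[i]} :=
  fun f => `[< smooth f /\ compact (closure [set x | f x != 0]) >].

Lemma pderiv_cat w1 w2 f : pderiv w1 (pderiv w2 f) = pderiv (w1 ++ w2) f.
Proof. by rewrite /pderiv foldr_cat. Qed.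

Lemma pderivL (a : R[i]) f g w : smooth f -> smooth g ->
  pderiv w (a *: f + g) = a *: pderiv w f + pderiv w g.
Proof.
move=> sf sg; elim: w => //= i w ->; apply/funext => x.
by have [] := cderiveL a ((sf w).2 i x) ((sg w).2 i x).
Qed.

Lemma pderiv0 w : pderiv w 0 = 0.
Proof.
elim: w => //= i w ->; apply/funext => x.
apply: cderive_near0; near=> y; reflexivity.
Unshelve. all: by end_near.
Qed.

Lemma smooth0 : smooth 0.
Proof.
move=> w; rewrite pderiv0; split; first exact: ccontinuous_cst.
by move=> i x; split; exact: derivable_cst.
Qed.

Lemma smoothL (a : R[i]) f g : smooth f -> smooth g -> smooth (a *: f + g).
Proof.
move=> sf sg w; rewrite pderivL//; split.
  by apply: ccontinuousL; [case: (sf w)|case: (sg w)].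
by move=> i x; have [] := cderiveL a ((sf w).2 i x) ((sg w).2 i x).
Qed.

Lemma smooth_pderiv w f : smooth f -> smooth (pderiv w f).
Proof. by move=> sf w'; rewrite pderiv_cat. Qed.

Lemma compact_suppL (K : set V) f : compact K -> (forall x, ~ K x -> f x = 0) ->
  compact (closure [set x | f x != 0]).
Proof.
move=> cK f0; apply: (subclosed_compact _ cK); first exact: closed_closure.
have clK : closed K by apply: compact_closed => //; exact: norm_hausdorff.
rewrite [X in _ `<=` X](closure_id _).1//; apply: closure_subset => x /= /eqP fx.
by apply: contrapT => /f0.
Qed.

Lemma test_submod_closed : submod_closed test_pred.
Proof.
split.
  apply/asboolP; split; first exact: smooth0.
  by apply: (@compact_suppL set0) => //; exact: compact0.
move=> a f g /asboolP[sf kf] /asboolP[sg kg]; apply/asboolP; split.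
  exact: smoothL.
apply: (@compact_suppL _ _ (compactU kf kg)) => x /not_orP[fx gx].
have {}fx : f x = 0.
  by apply: contrapT => /eqP h; apply: fx; exact: subset_closure.
have {}gx : g x = 0.
  by apply: contrapT => /eqP h; apply: gx; exact: subset_closure.
by rewrite -[LHS]/(a * f x + g x) fx gx mulr0 addr0.
Qed.

HB.instance Definition _ := GRing.isSubmodClosed.Build _ _ test_pred
  test_submod_closed.

Record testfun := TestFun { tf_fun :> V -> R[i]; _ : test_pred tf_fun }.
HB.instance Definition _ := [isSub for tf_fun].
HB.instance Definition _ := [Choice of testfun by <:].
HB.instance Definition _ := [SubChoice_isSubLmodule of testfun by <:].

End TestFunctions.

Section TestFunctionsTheory.
Context (R : realType) (m : nat).
Local Notation V := 'rV[R]_m.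
Implicit Types (f g : testfun R m) (w : seq 'I_m).

Lemma testfunP f : smooth f /\ compact (closure [set x | f x != 0]).
Proof. exact/asboolP/(valP f). Qed.

Lemma testfun_smooth f : smooth f. Proof. by have [] := testfunP f. Qed.

Lemma testfun_eq f g : f =1 g -> f = g.
Proof. by move=> fg; apply/val_inj/funext. Qed.

Lemma testfunLE (a : R[i]) f g x : (a *: f + g) x = a * f x + g x.
Proof. by []. Qed.

Lemma testfunL (a : R[i]) f g : tf_fun (a *: f + g) = a *: tf_fun f + tf_fun g.
Proof. by []. Qed.

Lemma testfunDE f g x : (f + g) x = f x + g x. Proof. by []. Qed.

Lemma testfunZE a f x : (a *: f) x = a * f x. Proof. by []. Qed.

Lemma testfun0 x : (0 : testfun R m) x = 0. Proof. by []. Qed.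

Lemma testfun_pderivL (a : R[i]) f g w x :
  pderiv w (a *: f + g) x = a * pderiv w f x + pderiv w g x.
Proof. by rewrite testfunL pderivL//; exact: testfun_smooth. Qed.

Lemma pderiv_supp w (h : V -> R[i]) (K : set V) : closed K ->
  (forall x, ~ K x -> h x = 0) -> forall x, ~ K x -> pderiv w h x = 0.
Proof.
move=> clK h0; elim: w => //= i w ih x Kx; apply: cderive_near0.
have : open (~` K) by exact: closed_openC.
rewrite openE => /(_ x Kx); rewrite /interior/= => nK.
by near=> y; apply: ih; exact: (near nK y).
Unshelve. all: by end_near. Qed.

Lemma testfun_partial_subproof (i : 'I_m) f :
  test_pred (cderive (delta_mx 0 i) f).
Proof.
have [sf kf] := testfunP f; apply/asboolP; split.
  exact: (@smooth_pderiv _ _ [:: i]).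
apply: (compact_suppL kf); apply: (@pderiv_supp [:: i]).
  exact: closed_closure.
by move=> x h; apply: contrapT => /eqP fx; apply: h; exact: subset_closure.
Qed.

Definition tpartial (i : 'I_m) f : testfun R m :=
  TestFun (testfun_partial_subproof i f).

Lemma tpartialL i (a : R[i]) f g :
  tpartial i (a *: f + g) = a *: tpartial i f + tpartial i g.
Proof. by apply: testfun_eq => x; exact: (testfun_pderivL a f g [:: i]). Qed.

(* The LF topology of D(R^m) enters only through its null sequences: a linear
   map from D(R^m) to a locally convex space is continuous as soon as it is
   sequentially continuous at 0, because D(R^m) is bornological. *)
Definition tf_cvg0 (psi_ : nat -> testfun R m) : Prop :=
  (exists2 K : set V, compact K & forall n x, ~ K x -> psi_ n x = 0) /\
  (forall w (eps : R), 0 < eps ->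
     \forall n \near \oo, forall x, normc (pderiv w (psi_ n) x) <= eps).

Lemma tf_cvg0_partial i psi_ : tf_cvg0 psi_ -> tf_cvg0 (tpartial i \o psi_).
Proof.
move=> [[K cK f0] fc]; split.
  exists K => // n; apply: (@pderiv_supp [:: i]); last exact: f0.
  by apply: compact_closed => //; exact: norm_hausdorff.
move=> w eps e0; have := fc (w ++ [:: i]) _ e0.
apply: filterS => n + x => /(_ x).
by rewrite -pderiv_cat.
Qed.

Definition distr_pred : {pred testfun R m -> R[i]} := fun T =>
  `[< (forall (a : R[i]) f g, T (a *: f + g) = a * T f + T g) /\
      forall psi_, tf_cvg0 psi_ -> normc (T (psi_ n)) @[n --> \oo] --> (0 : R) >].

Lemma cvg0_comb (a : R[i]) (u v : nat -> R[i]) :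
  normc (u n) @[n --> \oo] --> (0 : R) ->
  normc (v n) @[n --> \oo] --> (0 : R) ->
  normc (a * u n + v n) @[n --> \oo] --> (0 : R).
Proof.
move=> cu cv.
apply: (@squeeze_cvgr _ _ _ _ (fun=> 0) (fun n => normc a * normc (u n) + normc (v n))).
- near=> n; rewrite normc_ge0/=.
  by rewrite (le_trans (normcD _ _))// Normc.normcM.
- exact: cvg_cst.
- rewrite -[X in _ --> X]addr0; apply: cvgD => //.
  by rewrite -(mulr0 (normc a)); apply: cvgM => //; exact: cvg_cst.
Unshelve. all: by end_near. Qed.

Lemma distr_submod_closed : submod_closed distr_pred.
Proof.
split.
  apply/asboolP; split; first by move=> a f g; rewrite mulr0 addr0.
  by move=> psi_ _; under eq_fun do rewrite Normc.normc0; exact: cvg_cst.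
move=> a S T /asboolP[S1 S2] /asboolP[T1 T2]; apply/asboolP; split.
  move=> b f g; rewrite -![(a *: S + T) _]/(a * S _ + T _) S1 T1; ring.
by move=> psi_ f0; apply: cvg0_comb; [exact: S2|exact: T2].
Qed.

HB.instance Definition _ := GRing.isSubmodClosed.Build _ _ distr_pred
  distr_submod_closed.

Record distr := Distr { distr_fun :> testfun R m -> R[i]; _ : distr_pred distr_fun }.
HB.instance Definition _ := [isSub for distr_fun].
HB.instance Definition _ := [Choice of distr by <:].
HB.instance Definition _ := [SubChoice_isSubLmodule of distr by <:].

Implicit Types (S T : distr).

Lemma distrP T : (forall (a : R[i]) f g, T (a *: f + g) = a * T f + T g) /\
  forall psi_, tf_cvg0 psi_ -> normc (T (psi_ n)) @[n --> \oo] --> (0 : R).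
Proof. exact/asboolP/(valP T). Qed.

Lemma distr_eq S T : S =1 T -> S = T.
Proof. by move=> ST; apply/val_inj/funext. Qed.

Lemma distrLE (a : R[i]) S T f : (a *: S + T) f = a * S f + T f.
Proof. by []. Qed.

Lemma distrL T (a : R[i]) f g : T (a *: f + g) = a * T f + T g.
Proof. by have [] := distrP T. Qed.

Lemma distr_cvg0 T psi_ : tf_cvg0 psi_ -> normc (T (psi_ n)) @[n --> \oo] --> (0 : R).
Proof. by have [_] := distrP T; exact. Qed.

Lemma distr_partial_subproof (i : 'I_m) T : distr_pred (fun f => - T (tpartial i f)).
Proof.
apply/asboolP; split.
  by move=> a f g; rewrite tpartialL distrL; ring.
move=> psi_ f0; under eq_fun do rewrite normcN.
exact: (distr_cvg0 T (tf_cvg0_partial i f0)).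
Qed.

Definition dpartial (i : 'I_m) T : distr := Distr (distr_partial_subproof i T).

Lemma dpartialL i (a : R[i]) S T :
  dpartial i (a *: S + T) = a *: dpartial i S + dpartial i T.
Proof.
apply: distr_eq => f; rewrite -[LHS]/(- (a * S (tpartial i f) + T (tpartial i f))).
rewrite -[RHS]/(a * - S (tpartial i f) + - T (tpartial i f)); ring.
Qed.

Definition dmonomial (k : multinom m) T : distr :=
  foldr (fun i S => iter (k i) (dpartial i) S) T (enum 'I_m).

Definition dpolynomial (a : mpoly m R[i]) T : distr :=
  \sum_(k <- msupp a) mcoeff k a *: dmonomial k T.

Lemma dmonomialL k (a : R[i]) S T :
  dmonomial k (a *: S + T) = a *: dmonomial k S + dmonomial k T.
Proof.
rewrite /dmonomial; elim: (enum _) => //= i s ->.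
by elim: (k i) => //= n ->; rewrite dpartialL.
Qed.

Lemma dpolynomialL p (a : R[i]) S T :
  dpolynomial p (a *: S + T) = a *: dpolynomial p S + dpolynomial p T.
Proof.
rewrite /dpolynomial scaler_sumr -big_split/=; apply: eq_bigr => k _.
by rewrite dmonomialL scalerDr !scalerA mulrC.
Qed.

Definition distr_cvg0s (A_ : nat -> distr) : Prop :=
  forall f, normc (A_ n f) @[n --> \oo] --> (0 : R).

Lemma distr_cvg0s_partial i A_ : distr_cvg0s A_ ->
  distr_cvg0s (dpartial i \o A_).
Proof.
by move=> h f; rewrite /=; under eq_fun do rewrite normcN; exact: h.
Qed.

Lemma distr_cvg0sL a B_ A_ : distr_cvg0s B_ -> distr_cvg0s A_ ->
  distr_cvg0s (fun n => a *: B_ n + A_ n).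
Proof. by move=> hS hT f; apply: cvg0_comb; [exact: hS|exact: hT]. Qed.

Lemma distr_cvg0s0 : distr_cvg0s (fun=> 0).
Proof. by move=> f; under eq_fun do rewrite Normc.normc0; exact: cvg_cst. Qed.

Lemma distr_cvg0s_polynomial p A_ : distr_cvg0s A_ ->
  distr_cvg0s (dpolynomial p \o A_).
Proof.
move=> h; rewrite /dpolynomial/=.
have hm k : distr_cvg0s (dmonomial k \o A_).
  rewrite /dmonomial/=; elim: (enum _) => //= i s ih.
  by elim: (k i) => //= n; exact: distr_cvg0s_partial.
suff H s : distr_cvg0s (fun n => \sum_(k <- s) mcoeff k p *: dmonomial k (A_ n)).
  exact: H.
elim: s => [|k s ih].
  rewrite (_ : (fun n => _) = fun=> 0); first exact: distr_cvg0s0.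
  by apply/funext => n; rewrite big_nil.
rewrite (_ : (fun n => _) = (fun n => mcoeff k p *: dmonomial k (A_ n) +
   \sum_(j <- s) mcoeff j p *: dmonomial j (A_ n))).
  exact: distr_cvg0sL (hm k) ih.
by apply/funext => n; rewrite big_cons.
Qed.

End TestFunctionsTheory.

Section VectorDistributions.
Context (R : realType) (d : nat).
Local Notation D1 := (testfun R 1).
Local Notation D' := (distr R d).

(* Continuity for the weak-* topology of D'(R^d); for linear maps on D(R) it
   agrees with continuity for the strong topology, both topologies having the
   same bounded sets. *)
Definition vdistr_pred : {pred D1 -> D'} := fun U =>
  `[< (forall (a : R[i]) f g, U (a *: f + g) = a *: U f + U g) /\
      forall psi_, tf_cvg0 psi_ -> distr_cvg0s (U \o psi_) >].

Lemma vdistr_submod_closed : submod_closed vdistr_pred.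
Proof.
split.
  apply/asboolP; split; first by move=> a f g; rewrite scaler0 addr0.
  by move=> psi_ _; exact: distr_cvg0s0.
move=> a S T /asboolP[S1 S2] /asboolP[T1 T2]; apply/asboolP; split.
  move=> b f g; rewrite -![(a *: S + T) _]/(a *: S _ + T _) S1 T1.
  rewrite !scalerDr !scalerA [b * a]mulrC -!addrA; congr (_ + _).
  by rewrite addrCA.
by move=> psi_ f0; apply: distr_cvg0sL; [exact: S2|exact: T2].
Qed.

HB.instance Definition _ := GRing.isSubmodClosed.Build _ _ vdistr_pred
  vdistr_submod_closed.

Record vdistr := VDistr { vdistr_fun :> D1 -> D'; _ : vdistr_pred vdistr_fun }.
HB.instance Definition _ := [isSub for vdistr_fun].
HB.instance Definition _ := [Choice of vdistr by <:].
HB.instance Definition _ := [SubChoice_isSubLmodule of vdistr by <:].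

Lemma vdistrP (U : vdistr) :
  (forall (a : R[i]) f g, U (a *: f + g) = a *: U f + U g) /\
  forall psi_, tf_cvg0 psi_ -> distr_cvg0s (U \o psi_).
Proof. exact/asboolP/(valP U). Qed.

Lemma vderiv_subproof (U : vdistr) :
  vdistr_pred (fun phi => - U (tpartial ord0 phi)).
Proof.
have [U1 U2] := vdistrP U; apply/asboolP; split.
  by move=> a f g; rewrite tpartialL U1 opprD scalerN.
move=> psi_ f0 psi; rewrite /=.
under eq_fun do rewrite -[(- _) psi]/(- (U _ psi)) normcN.
exact: (U2 _ (tf_cvg0_partial ord0 f0)).
Qed.

Definition vderiv (U : vdistr) : vdistr := VDistr (vderiv_subproof U).

Lemma vpolynomial_subproof (a : mpoly d R[i]) (U : vdistr) :
  vdistr_pred (fun phi => dpolynomial a (U phi)).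
Proof.
have [U1 U2] := vdistrP U; apply/asboolP; split.
  by move=> b f g; rewrite U1 dpolynomialL.
by move=> psi_ f0; apply: (distr_cvg0s_polynomial a (U2 _ f0)).
Qed.

Definition vpolynomial (a : mpoly d R[i]) (U : vdistr) : vdistr :=
  VDistr (vpolynomial_subproof a U).

Definition Dop (p : {poly mpoly d R[i]}) (U : vdistr) : vdistr :=
  \sum_(k < size p) vpolynomial p`_k (iter k vderiv U).

End VectorDistributions.

Section Completeness.
Context (R : realType).

Lemma unif_limit_continuous (T : topologicalType) (f : nat -> T -> R) (F : T -> R) :
  (forall n, continuous (f n)) ->
  (forall eps, 0 < eps -> \forall n \near \oo, forall x, `|f n x - F x| <= eps) ->
  continuous F.
Proof.
move=> cf fF x; apply/cvgrPdist_le => e e0.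
have e3 : 0 < e / 3 by rewrite divr_gt0.
have [N _ /(_ N (leqnn N)) /= HN] := fF _ e3.
have /cvgrPdist_le /(_ _ e3) H := cf N x.
near=> y.
have h1 : `|f N x - f N y| <= e / 3 by near: y.
have h2 := HN x; have h3 := HN y.
rewrite (_ : F x - F y = - (f N x - F x) + (f N x - f N y) + (f N y - F y)); last by ring.
have := ler_normD (- (f N x - F x) + (f N x - f N y)) (f N y - F y).
have := ler_normD (- (f N x - F x)) (f N x - f N y).
rewrite normrN; lra.
Unshelve. all: by end_near. Qed.

Lemma cauchy_real (a : nat -> R) :
  (forall eps, 0 < eps -> exists N, forall n, (N <= n)%N -> `|a n - a N| <= eps) ->
  cvgn a.
Proof.
move=> h; apply/cauchy_cvgP; apply: cauchy_exP => e e0.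
have e2 : 0 < e / 2 by rewrite divr_gt0.
have [N HN] := h _ e2; exists (a N); exists N => // n /= Nn.
rewrite /ball /= distrC; apply: le_lt_trans (HN _ Nn) _; lra.
Qed.

Lemma lim_bound (a : nat -> R) (l c e : R) (N : nat) : a n @[n --> \oo] --> l ->
  (forall n, (N <= n)%N -> `|a n - c| <= e) -> `|l - c| <= e.
Proof.
move=> al h.
have cv : `|a n - c| @[n --> \oo] --> `|l - c|.
  by apply: cvg_norm; apply: cvgB => //; exact: cvg_cst.
apply: (@closed_cvg _ _ _ _ _ (fun y => y <= e) _ _ _ cv); first exact: closed_le.
by exists N.
Qed.

Context (m : nat).
Local Notation V := 'rV[R]_m.

Lemma test_complete (S : nat -> testfun R m) (K : set V) : compact K ->
  (forall n x, ~ K x -> S n x = 0) ->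
  (forall w (eps : R), 0 < eps -> exists N, forall n, (N <= n)%N -> forall x,
     normc (pderiv w (S n) x - pderiv w (S N) x) <= eps) ->
  exists psi, tf_cvg0 (fun n => S n - psi).
Proof.
move=> cK S0 SC.
pose F w x : R[i] := (lim (complex.Re (pderiv w (S n) x) @[n --> \oo]) +i*
  lim (complex.Im (pderiv w (S n) x) @[n --> \oo]))%C.
have ReB (x y : R[i]) : complex.Re (x - y) = complex.Re x - complex.Re y.
  by case: x y => [a b] [c e].
have ImB (x y : R[i]) : complex.Im (x - y) = complex.Im x - complex.Im y.
  by case: x y => [a b] [c e].
have cvR w x : complex.Re (pderiv w (S n) x) @[n --> \oo] --> complex.Re (F w x).
  apply: cauchy_real => e e0; have [N HN] := SC w _ e0; exists N => n Nn.
  by rewrite -ReB (le_trans (normc_Re _))// HN.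
have cvI w x : complex.Im (pderiv w (S n) x) @[n --> \oo] --> complex.Im (F w x).
  apply: cauchy_real => e e0; have [N HN] := SC w _ e0; exists N => n Nn.
  by rewrite -ImB (le_trans (normc_Im _))// HN.
have FS w eps : 0 < eps -> \forall n \near \oo, forall x,
    normc (pderiv w (S n) x - F w x) <= eps.
  move=> e0; have e4 : 0 < eps / 4 by rewrite divr_gt0.
  have [N HN] := SC w _ e4; exists N => // n /= Nn x.
  have cN k : (N <= k)%N -> normc (pderiv w (S k) x - pderiv w (S n) x) <= eps / 2.
    move=> Nk; rewrite (_ : _ - _ = (pderiv w (S k) x - pderiv w (S N) x) -
       (pderiv w (S n) x - pderiv w (S N) x)); last by ring.
    apply: le_trans (normcB _ _) _.
    have := HN k Nk x; have := HN n Nn x; lra.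
  apply: le_trans (normc_le _) _.
  rewrite ReB ImB distrC [X in _ + X]distrC.
  suff : `|complex.Re (F w x) - complex.Re (pderiv w (S n) x)| <= eps / 2 /\
     `|complex.Im (F w x) - complex.Im (pderiv w (S n) x)| <= eps / 2 by move=> []; lra.
  split.
    apply: (lim_bound (cvR w x) (N := N)) => k Nk.
    by rewrite -ReB (le_trans (normc_Re _))// cN.
  apply: (lim_bound (cvI w x) (N := N)) => k Nk.
  by rewrite -ImB (le_trans (normc_Im _))// cN.
have Scont n w : ccontinuous (pderiv w (S n)) by have [] := testfun_smooth (S n) w.
have Sder n w i x : cderivable (pderiv w (S n)) x (delta_mx 0 i).
  by have [_] := testfun_smooth (S n) w; exact.
have Fcont w : ccontinuous (F w).
  split.
    apply: (@unif_limit_continuous _ (fun n x => complex.Re (pderiv w (S n) x))).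
      by move=> n; have [] := Scont n w.
    move=> e e0; apply: filterS (FS w e e0) => n h x.
    by rewrite -ReB (le_trans (normc_Re _)).
  apply: (@unif_limit_continuous _ (fun n x => complex.Im (pderiv w (S n) x))).
    by move=> n; have [] := Scont n w.
  move=> e e0; apply: filterS (FS w e e0) => n h x.
  by rewrite -ImB (le_trans (normc_Im _)).
have FderR w i x : is_derive x (delta_mx 0 i) (fun y => complex.Re (F w y))
    (complex.Re (F (i :: w) x)).
  apply: (@unif_limit_derive _ _ (fun n x => complex.Re (pderiv w (S n) x)) _
    (fun y => complex.Re (F (i :: w) y))) => //.
    by move=> n y; have [] := Sder n w i y.
  move=> e e0; apply: filterS (FS (i :: w) e e0) => n h y.
  by have := le_trans (normc_Re _) (h y); rewrite ReB.
have FderI w i x : is_derive x (delta_mx 0 i) (fun y => complex.Im (F w y))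
    (complex.Im (F (i :: w) x)).
  apply: (@unif_limit_derive _ _ (fun n x => complex.Im (pderiv w (S n) x)) _
    (fun y => complex.Im (F (i :: w) y))) => //.
    by move=> n y; have [] := Sder n w i y.
  move=> e e0; apply: filterS (FS (i :: w) e e0) => n h y.
  by have := le_trans (normc_Im _) (h y); rewrite ImB.
have FE w : pderiv w (F [::]) = F w.
  elim: w => //= i w ->; apply/funext => x.
  rewrite /cderive (@derive_val _ _ _ _ _ _ _ (FderR w i x)).
  by rewrite (@derive_val _ _ _ _ _ _ _ (FderI w i x)).
have F0 x : ~ K x -> F [::] x = 0.
  move=> Kx; rewrite /F.
  have -> : (fun n => complex.Re (pderiv [::] (S n) x)) = cst 0.
    by apply/funext => n /=; rewrite S0.
  have -> : (fun n => complex.Im (pderiv [::] (S n) x)) = cst 0.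
    by apply/funext => n /=; rewrite S0.
  by rewrite !lim_cst.
have FT : test_pred (F [::]).
  apply/asboolP; split; last exact: compact_suppL F0.
  move=> w; rewrite FE; split; [exact: Fcont|move=> i x; split].
    by have [] := FderR w i x.
  by have [] := FderI w i x.
exists (TestFun FT); split.
  exists K => // n x Kx; rewrite addrC -scaleN1r testfunLE.
  by rewrite S0//= F0// mulr0 addr0.
move=> w e e0; apply: filterS (FS w e e0) => n h x.
by rewrite addrC -scaleN1r testfun_pderivL mulN1r addrC /= FE.
Qed.

End Completeness.

(* Banach-Steinhaus for D(R^m), by a gliding hump argument: it is what makes
   psi |-> \int phi(t) <u(t), psi> dt a distribution when u is continuous. *)
Section UniformBoundedness.
Context (R : realType) (m : nat).
Local Notation V := 'rV[R]_m.
Local Notation half := (2^-1 : R).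

Lemma geometric_bound (a : nat -> R[i]) (N : nat) :
  (forall n, (N <= n)%N -> normc (a n.+1 - a n) <= half ^+ n) ->
  forall n, (N <= n)%N -> normc (a n - a N) <= 2 * half ^+ N.
Proof.
move=> h n Nn; rewrite -(subnKC Nn); move: (n - N)%N => {n Nn} k.
suff H : normc (a (N + k)%N - a N) <= 2 * half ^+ N - 2 * half ^+ (N + k).
  by apply: le_trans H _; rewrite gerBl mulr_ge0// exprn_ge0// invr_ge0.
elim: k => [|k ih]; first by rewrite addn0 !subrr Normc.normc0.
have H := h (N + k)%N (leq_addr _ _).
rewrite addnS (_ : _ - _ = (a (N + k).+1 - a (N + k)%N) + (a (N + k)%N - a N)); last by ring.
apply: le_trans (normcD _ _) _; rewrite exprS mulrA mulfV// mul1r.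
lra.
Qed.

Lemma near_words (psi_ : nat -> testfun R m) (j : nat) (eps : R) : 0 < eps ->
  tf_cvg0 psi_ -> \forall n \near \oo, forall w, (size w <= j)%N ->
    forall x, normc (pderiv w (psi_ n) x) <= eps.
Proof.
move=> e0 [_ h].
have : \forall n \near \oo, forall w : {bseq j of 'I_m},
    forall x, normc (pderiv w (psi_ n) x) <= eps.
  by apply: filter_forall => w; exact: h.
by apply: filterS => n H w sw; exact: (H (Bseq sw)).
Qed.

Lemma distrB (T : distr R m) f g : T (f - g) = T f - T g.
Proof. by rewrite addrC -scaleN1r distrL mulN1r addrC. Qed.

Lemma distrD (T : distr R m) f g : T (f + g) = T f + T g.
Proof. by rewrite -{1}[f]scale1r distrL mul1r. Qed.

Lemma distrZ (T : distr R m) a f : T (a *: f) = a * T f.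
Proof.
have T0 : T 0 = 0 by rewrite -[X in T X](subrr 0) distrB subrr.
by rewrite -[a *: f]addr0 distrL T0 addr0.
Qed.

Lemma testfun_pderivD w (f g : testfun R m) x :
  pderiv w (f + g) x = pderiv w f x + pderiv w g x.
Proof. by rewrite -{1}[f]scale1r testfun_pderivL mul1r. Qed.

Lemma testfun_pderivZ w a (f : testfun R m) x :
  pderiv w (a *: f) x = a * pderiv w f x.
Proof.
rewrite (_ : tf_fun (a *: f) = a *: tf_fun f + 0); last by rewrite addr0.
rewrite pderivL; [|exact: testfun_smooth|exact: smooth0].
by rewrite pderiv0 addr0.
Qed.

Theorem uniform_boundedness (u : R -> distr R m) (A : R) (psi_ : nat -> testfun R m) :
  (forall psi, ccontinuous (fun t => u t psi)) -> tf_cvg0 psi_ ->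
  forall eps : R, 0 < eps -> \forall n \near \oo,
    forall t, `|t| <= A -> normc (u t (psi_ n)) <= eps.
Proof.
move=> cu psi0 eps eps0; apply: contrapT => notnear.
have inf N : exists n t, [/\ (N <= n)%N, `|t| <= A & eps < normc (u t (psi_ n))].
  apply: contrapT => H; apply: notnear; exists N => // n /= Nn t tA.
  by rewrite leNgt; apply/negP => ?; apply: H; exists n, t.
have [K cK psiK] := psi0.1.
have bnd psi : exists B, 0 <= B /\ forall t, `|t| <= A -> normc (u t psi) <= B.
  have [A0|A0] := leP 0 A; last first.
    by exists 0; split=> // t /(le_trans (normr_ge0 _)); rewrite leNgt A0.
  have AA : - A <= A by lra.
  have [c _ Hc] := EVT_max AA (continuous_subspaceT (normc_continuous (cu psi))).
  exists (normc (u c psi)); split; first exact: normc_ge0.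
  by move=> t; rewrite ler_norml => tA; apply: Hc; rewrite in_itv.
have [B HB] := choice bnd.
have B0 psi : 0 <= B psi by have [] := HB psi.
have half0 n : 0 < half ^+ n by rewrite exprn_gt0 ?invr_gt0.
pose T := (testfun R m * R)%type.
pose P (s : seq T) (e : T) := [/\ `|e.2| <= A, forall x, ~ K x -> e.1 x = 0,
  forall w, (size w <= size s)%N -> forall x, normc (pderiv w e.1 x) <= half ^+ size s,
  forall e', e' \in s -> normc (u e'.2 e.1) <= half ^+ size s &
  (size s)%:R + 2 + \sum_(e' <- s) B e'.1 <= normc (u e.2 e.1)].
have step s : exists e, P s e.
  pose L := (size s)%:R + 2 + \sum_(e' <- s) B e'.1.
  have L0 : 0 < L.
    have sg : 0 <= \sum_(e' <- s) B e'.1 by apply: sumr_ge0.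
    have := ler0n R (size s); rewrite /L; lra.
  pose c := L / eps; have c0 : 0 < c by rewrite divr_gt0.
  have [b bE] : exists b, b = half ^+ size s / c by exists (half ^+ size s / c).
  have h0 : 0 < b by rewrite bE divr_gt0.
  have W := near_words (size s) h0 psi0.
  have E : \forall n \near \oo, forall e', e' \in s ->
     normc (u e'.2 (psi_ n)) <= b.
    elim: (s) => [|e' s' ih]; first exact: nearW.
    have H : \forall n \near \oo, normc (u e'.2 (psi_ n)) <= b.
      have /cvgrPdist_le /(_ _ h0) := distr_cvg0 (u e'.2) psi0.
      by apply: filterS => n; rewrite sub0r normrN ger0_norm// normc_ge0.
    apply: filterS2 H ih => n h1 h2 f.
    by rewrite in_cons => /orP[/eqP ->|]; [exact: h1|exact: h2].
  have [N _ HN] := filterI W E.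
  have [n [t [Nn tA big]]] := inf N.
  have [HW HE] := HN n Nn.
  have nc : normc (c%:C)%C = c by rewrite normc_real gtr0_norm.
  exists ((c%:C)%C *: psi_ n, t); split => //=.
  - by move=> x Kx; rewrite -[LHS]/(_ * _) psiK// mulr0.
  - move=> w sw x; rewrite testfun_pderivZ Normc.normcM nc mulrC -ler_pdivlMr// -bE.
    exact: HW.
  - move=> e' e's; rewrite distrZ Normc.normcM nc mulrC -ler_pdivlMr// -bE.
    exact: HE.
  - rewrite distrZ Normc.normcM nc -/L.
    rewrite /c -mulrA; apply: ler_peMr; first exact: ltW.
    by rewrite mulrC ler_pdivlMr// mul1r ltW.
have [nx Hnx] := choice step.
pose st n := iter n (fun s => nx s :: s) [::].
pose e n := nx (st n).
have sst n : size (st n) = n by elim: n => //= n ->.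
have He n : P (st n) (e n) by exact: Hnx.
have est i n : (i < n)%N -> e i \in st n.
  elim: n => // n ih; rewrite ltnS leq_eqVlt => /orP[/eqP ->|/ih h]; rewrite in_cons.
    by rewrite eqxx.
  by rewrite h orbT.
have sumst n : \sum_(e' <- st n) B e'.1 = \sum_(i < n) B (e i).1.
  elim: n => [|n ih]; first by rewrite big_nil big_ord0.
  by rewrite [st _]/= big_cons big_ord_recr/= ih addrC.
pose S n := \sum_(i < n) (e i).1.
have SS n : S n.+1 = S n + (e n).1 by rewrite /S big_ord_recr.
have S0 n x : ~ K x -> S n x = 0.
  move=> Kx; elim: n => [|n ih]; first by rewrite /S big_ord0.
  rewrite SS -[LHS]/(S n x + (e n).1 x) ih add0r.
  by have [_ + _ _ _] := He n; exact.
have SC w (eta : R) : 0 < eta -> exists N, forall n, (N <= n)%N -> forall x,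
    normc (pderiv w (S n) x - pderiv w (S N) x) <= eta.
  move=> eta0.
  have : 2 * half ^+ n @[n --> \oo] --> (2 * 0 : R).
    by apply: cvgM; [exact: cvg_cst|apply: cvg_expr; rewrite ger0_norm; lra].
  rewrite mulr0 => /cvgrPdist_le /(_ _ eta0)[M _ HM].
  exists (maxn M (size w)) => n Nn x.
  have G : normc (pderiv w (S n) x - pderiv w (S (maxn M (size w))) x) <=
      2 * half ^+ maxn M (size w).
    apply: (@geometric_bound (fun n => pderiv w (S n) x)) Nn => k.
    rewrite geq_max => /andP[_ wk]; rewrite SS testfun_pderivD addrAC subrr add0r.
    by have [_ _ + _ _] := He k; rewrite sst; exact.
  apply: le_trans G _.
  have := HM (maxn M (size w)) (leq_maxl _ _); rewrite sub0r normrN.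
  by apply: le_trans; exact: ler_norm.
have [psi Spsi] := test_complete cK S0 SC.
have low j : j%:R <= normc (u (e j).2 psi).
  have [tA _ _ _ big] := He j.
  rewrite sst sumst in big.
  set t := (e j).2 in tA big *.
  have h1 : normc (u t (S j)) <= \sum_(i < j) B (e i).1.
    elim: (j) => [|k ih].
      by rewrite /S !big_ord0 -(subrr 0) distrB subrr Normc.normc0.
    rewrite SS distrD big_ord_recr /= (le_trans (normcD _ _))// lerD//.
    by have [_] := HB (e k).1; exact.
  have h2 n : (j.+1 <= n)%N -> normc (u t (S n) - u t (S j.+1)) <= 2 * half ^+ j.+1.
    apply: (@geometric_bound (fun n => u t (S n))) => k jk.
    rewrite SS distrD addrAC subrr add0r.
    by have [_ _ _ + _] := He k; rewrite sst; apply; exact: est.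
  have h3 : 2 * half ^+ j.+1 <= 1.
    by rewrite exprS mulrA mulfV// mul1r exprn_ile1//; lra.
  have /cvgrPdist_le /(_ _ ltr01)[N _ HN] := distr_cvg0 (u t) Spsi.
  have := HN (maxn N j.+1) (leq_maxl _ _).
  rewrite sub0r normrN ger0_norm ?normc_ge0// distrB => h4.
  have := h2 (maxn N j.+1) (leq_maxr _ _).
  set X := u t (S (maxn _ _)) in h4 * => h5.
  have h6 : u t (e j).1 = (u t psi + (X - u t psi)) - (X - u t (S j.+1)) - u t (S j).
    by rewrite SS distrD; ring.
  have := normcB ((u t psi + (X - u t psi)) - (X - u t (S j.+1))) (u t (S j)).
  rewrite -h6.
  have := normcB (u t psi + (X - u t psi)) (X - u t (S j.+1)).
  have := normcD (u t psi) (X - u t psi).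
  lra.
have [_ HBpsi] := HB psi.
have := low (Num.truncn (B psi)).+1.
have [tA _ _ _ _] := He (Num.truncn (B psi)).+1.
have := HBpsi _ tA.
have := truncnS_gt (B psi).
lra.
Qed.

End UniformBoundedness.

Section RegularDistributions.
Context (R : realType) (d : nat).
Local Notation mu := (@lebesgue_measure R).

(* D(R) is testfun R 1, and t : R is identified with const_mx t : 'rV[R]_1. *)

Lemma const_mxE1 (t : R) : const_mx t = t *: const_mx 1 :> 'rV[R]_1.
Proof. by apply/matrixP => i j; rewrite !mxE mulr1. Qed.

Lemma const_mx_continuous : continuous (fun t : R => const_mx t : 'rV[R]_1).
Proof.
move=> t; rewrite /continuous_at const_mxE1.
rewrite (_ : (fun s : R => const_mx s : 'rV[R]_1) = fun s => s *: const_mx 1).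
  by apply: cvgZr_tmp; exact: cvg_id.
by apply/funext => s; exact: const_mxE1.
Qed.

Lemma compact_line (K : set 'rV[R]_1) : compact K ->
  exists A : R, 0 <= A /\ forall t : R, A < `|t| -> ~ K (const_mx t).
Proof.
move=> /compact_bounded [M [_ HM]].
have n0 : 0 < `|const_mx 1 : 'rV[R]_1|.
  rewrite normr_gt0; apply/eqP => /matrixP /(_ ord0 ord0); rewrite !mxE.
  by apply/eqP; rewrite oner_eq0.
pose M' := Num.max M 0 + 1.
have MM' : M < M' by rewrite /M' ltr_pwDr// le_max lexx.
have M'0 : 0 <= M' by rewrite addr_ge0// le_max lexx orbT.
exists (M' / `|const_mx 1 : 'rV[R]_1|); split; first by rewrite divr_ge0// ltW.
move=> t tA Kt; have := HM _ MM' _ Kt; rewrite /= const_mxE1 normrZ.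
by rewrite leNgt -ltr_pdivrMr// tA.
Qed.

Lemma vanish_restrict (f : R -> R) (A : R) : (forall t, A < `|t| -> f t = 0) ->
  f \_ `[- A, A] = f.
Proof.
move=> f0; apply/funext => t; rewrite patchE.
case: ifPn => //; rewrite notin_setE/= in_itv/= -ler_norml => /negP.
by rewrite -ltNge => /f0.
Qed.

Lemma vanish_integrable (f : R -> R) (A : R) : continuous f ->
  (forall t, A < `|t| -> f t = 0) -> mu.-integrable setT (EFin \o f).
Proof.
move=> cf f0; rewrite -(vanish_restrict f0) -restrict_EFin.
apply/(integrable_mkcond _ _).1 => //.
apply: continuous_compact_integrable; first exact: segment_compact.
exact: continuous_subspaceT.
Qed.

Lemma vanish_bound (f : R -> R) (A M : R) : 0 <= A -> continuous f ->
  (forall t, A < `|t| -> f t = 0) -> (forall t, `|t| <= A -> `|f t| <= M) ->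
  `|\int[mu]_t f t| <= 2 * A * M.
Proof.
move=> A0 cf f0 fM.
rewrite -{1}(vanish_restrict f0) -Rintegral_mkcond.
have intf : mu.-integrable `[- A, A] (EFin \o f).
  apply: continuous_compact_integrable; first exact: segment_compact.
  exact: continuous_subspaceT.
apply: le_trans (le_normr_Rintegral _ intf) _ => //.
have -> : 2 * A * M = \int[mu]_(t in `[- A, A]) cst M t.
  have -> : \int[mu]_(t in `[- A, A]) cst M t = M * fine (mu `[- A, A]).
    by apply: Rintegral_cst.
  rewrite lebesgue_measure_itv/= lte_fin.
  case: ltP => h /=; first by ring.
  have -> : A = 0 by lra.
  ring.
apply: le_Rintegral => //.
- rewrite (_ : EFin \o _ = abse \o (EFin \o f)); last by [].
  exact: integrable_abse.
- apply: continuous_compact_integrable; first exact: segment_compact.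
  by apply: continuous_subspaceT => ?; exact: cvg_cst.
- by move=> t /=; rewrite in_itv/= -ler_norml; exact: fM.
Qed.

Lemma cintegralL (a : R[i]) (f g : R -> R[i]) (A : R) :
  ccontinuous f -> ccontinuous g ->
  (forall t, A < `|t| -> f t = 0) -> (forall t, A < `|t| -> g t = 0) ->
  cintegral (fun t => a * f t + g t) = a * cintegral f + cintegral g.
Proof.
move=> [f1 f2] [g1 g2] f0 g0.
have if1 : mu.-integrable setT (EFin \o (fun t => complex.Re (f t))).
  by apply: (@vanish_integrable _ A) => // t /f0 ->.
have if2 : mu.-integrable setT (EFin \o (fun t => complex.Im (f t))).
  by apply: (@vanish_integrable _ A) => // t /f0 ->.
have ig1 : mu.-integrable setT (EFin \o (fun t => complex.Re (g t))).
  by apply: (@vanish_integrable _ A) => // t /g0 ->.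
have ig2 : mu.-integrable setT (EFin \o (fun t => complex.Im (g t))).
  by apply: (@vanish_integrable _ A) => // t /g0 ->.
have cmb (b c : R) (x y z : R -> R) : mu.-integrable setT (EFin \o x) ->
    mu.-integrable setT (EFin \o y) -> mu.-integrable setT (EFin \o z) ->
    \int[mu]_t (b * x t + c * y t + z t) =
    b * (\int[mu]_t x t) + c * (\int[mu]_t y t) + \int[mu]_t z t.
  move=> ix iy iz.
  have ibx : mu.-integrable setT (EFin \o (fun t => b * x t)).
    by rewrite (_ : EFin \o _ = (fun t => b%:E * (EFin \o x) t)%E)//; exact: integrableZl.
  have icy : mu.-integrable setT (EFin \o (fun t => c * y t)).
    by rewrite (_ : EFin \o _ = (fun t => c%:E * (EFin \o y) t)%E)//; exact: integrableZl.
  have ibc : mu.-integrable setT (EFin \o (fun t => b * x t + c * y t)).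
    by rewrite (_ : EFin \o _ = ((EFin \o (fun t => b * x t)%R) \+
      (EFin \o (fun t => c * y t)%R))%E)//; exact: integrableD.
  rewrite RintegralD//.
  by rewrite RintegralD// !RintegralZl.
apply/eqP; rewrite eq_complex ReL ImL /=; apply/andP; split; apply/eqP.
  under eq_Rintegral do rewrite ReL -mulNr.
  by rewrite cmb// mulNr.
under eq_Rintegral do rewrite ImL.
by rewrite cmb.
Qed.

Lemma cintegral_bound (f : R -> R[i]) (A M : R) : 0 <= A -> ccontinuous f ->
  (forall t, A < `|t| -> f t = 0) -> (forall t, `|t| <= A -> normc (f t) <= M) ->
  normc (cintegral f) <= 4 * A * M.
Proof.
move=> A0 [f1 f2] f0 fM; apply: le_trans (normc_le _) _ => /=.
have h1 : `|\int[mu]_t complex.Re (f t)| <= 2 * A * M.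
  apply: vanish_bound => // t tA; first by rewrite f0.
  by rewrite (le_trans (normc_Re _))// fM.
have h2 : `|\int[mu]_t complex.Im (f t)| <= 2 * A * M.
  apply: vanish_bound => // t tA; first by rewrite f0.
  by rewrite (le_trans (normc_Im _))// fM.
lra.
Qed.

Lemma testfun_line (phi : testfun R 1) : ccontinuous (fun t : R => phi (const_mx t)).
Proof.
have [[c1 c2] _] := testfun_smooth phi [::].
split=> t.
  by apply: (@continuous_comp _ _ _ (fun t : R => const_mx t : 'rV[R]_1)
    (fun x => complex.Re (phi x))); [exact: const_mx_continuous|exact: c1].
by apply: (@continuous_comp _ _ _ (fun t : R => const_mx t : 'rV[R]_1)
  (fun x => complex.Im (phi x))); [exact: const_mx_continuous|exact: c2].
Qed.

Lemma testfun_line_supp (phi : testfun R 1) : exists A : R, 0 <= A /\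
  forall t, A < `|t| -> phi (const_mx t) = 0.
Proof.
have [_ /compact_line[A [A0 HA]]] := testfunP phi; exists A; split=> // t /HA h.
by apply: contrapT => /eqP pt; apply: h; exact: subset_closure.
Qed.

Lemma small_cvg0 (a : nat -> R[i]) (C : R) : 0 <= C ->
  (forall eps : R, 0 < eps -> \forall n \near \oo, normc (a n) <= C * eps) ->
  normc (a n) @[n --> \oo] --> (0 : R).
Proof.
move=> C0 h; apply/cvgrPdist_le => e e0.
have e' : 0 < e / (C + 1) by rewrite divr_gt0// ltr_wpDl.
apply: filterS (h _ e') => n hn; rewrite sub0r normrN ger0_norm ?normc_ge0//.
apply: le_trans hn _; rewrite mulrCA ger_pMr// ler_pdivrMr; lra.
Qed.

Definition dcontinuous (u : R -> distr R d) : Prop :=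
  forall psi, ccontinuous (fun t => u t psi).

Section Regular.
Variables (u : R -> distr R d) (cu : dcontinuous u).

Definition regular_pairing (phi : testfun R 1) (psi : testfun R d) : R[i] :=
  cintegral (fun t => phi (const_mx t) * u t psi).
Local Notation pair := regular_pairing.

Lemma pair_cont (phi : testfun R 1) psi : ccontinuous (fun t => phi (const_mx t) * u t psi).
Proof. by apply: ccontinuousM; [exact: testfun_line|exact: cu]. Qed.

Lemma regular_distr_subproof (phi : testfun R 1) : distr_pred (pair phi).
Proof.
have [A [A0 HA]] := testfun_line_supp phi.
have v0 psi t : A < `|t| -> phi (const_mx t) * u t psi = 0.
  by move=> /HA ->; rewrite mul0r.
apply/asboolP; split.
  move=> a f g; rewrite /regular_pairing -(@cintegralL a _ _ A);
    try exact: pair_cont; try exact: v0.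
  by congr cintegral; apply/funext => t; rewrite distrL; ring.
move=> psi_ psi0.
have [B [B0 HB]] : exists B, 0 <= B /\
    forall t, `|t| <= A -> normc (phi (const_mx t)) <= B.
  have AA : - A <= A by lra.
  have [c _ Hc] := EVT_max AA
    (continuous_subspaceT (normc_continuous (testfun_line phi))).
  exists (normc (phi (const_mx c))); split; first exact: normc_ge0.
  by move=> t; rewrite ler_norml => tA; apply: Hc; rewrite in_itv.
apply: (@small_cvg0 (fun n => pair phi (psi_ n)) (4 * A * B)); first by rewrite !mulr_ge0.
move=> eps eps0; apply: filterS (uniform_boundedness A cu psi0 eps0) => n Hn.
rewrite -mulrA; apply: cintegral_bound => //; [exact: pair_cont|exact: v0|move=> t tA].
by rewrite Normc.normcM ler_pM ?normc_ge0// ?HB// Hn.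
Qed.

Lemma regular_vdistr_subproof :
  vdistr_pred (fun phi => Distr (regular_distr_subproof phi)).
Proof.
apply/asboolP; split.
  move=> a f g; apply: distr_eq => psi.
  have [A [A0 HA]] := testfun_line_supp f; have [B [B0 HB]] := testfun_line_supp g.
  rewrite -[RHS]/(a * pair f psi + pair g psi).
  rewrite -(@cintegralL a _ _ (Num.max A B)); try exact: pair_cont.
  - by congr cintegral; apply/funext => t; rewrite testfunLE; ring.
  - by move=> t; rewrite gt_max => /andP[/HA -> _]; rewrite mul0r.
  - by move=> t; rewrite gt_max => /andP[_ /HB ->]; rewrite mul0r.
move=> phi_ [[K cK K0] c0] psi.
have [A [A0 HA]] := compact_line cK.
have [B [B0 HB]] : exists B, 0 <= B /\ forall t, `|t| <= A -> normc (u t psi) <= B.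
  have AA : - A <= A by lra.
  have [c _ Hc] := EVT_max AA (continuous_subspaceT (normc_continuous (cu psi))).
  exists (normc (u c psi)); split; first exact: normc_ge0.
  by move=> t; rewrite ler_norml => tA; apply: Hc; rewrite in_itv.
apply: (@small_cvg0 (fun n => pair (phi_ n) psi) (4 * A * B)); first by rewrite !mulr_ge0.
move=> eps eps0; apply: filterS (c0 [::] _ eps0) => n Hn.
rewrite -mulrA [B * eps]mulrC; apply: cintegral_bound => //; first exact: pair_cont.
  by move=> t /HA /K0 ->; rewrite mul0r.
by move=> t tA; rewrite Normc.normcM ler_pM ?normc_ge0// ?HB// Hn.
Qed.

Definition regular : vdistr R d := VDistr regular_vdistr_subproof.

Lemma regularE phi psi :
  regular phi psi = cintegral (fun t => phi (const_mx t) * u t psi).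
Proof. by []. Qed.

End Regular.

Definition dC1 (u : R -> distr R d) : Prop := forall psi,
  (forall t : R, cderivable (fun s : R => u s psi) t 1) /\
  ccontinuous (cderive (1 : R) (fun s : R => u s psi)).

Definition solution_set (p : {poly mpoly d R[i]}) : set (R -> distr R d) :=
  [set u | exists cu : dcontinuous u, Dop p (regular cu) = 0].

Definition concatenation (u1 u2 : R -> distr R d) : R -> distr R d :=
  fun t => if t <= 0 then u1 t else u2 t.

Definition concatenable (S : set (R -> distr R d)) : Prop :=
  forall u1 u2, S u1 -> dC1 u1 -> S u2 -> dC1 u2 -> u1 0 = u2 0 ->
  S (concatenation u1 u2).

End RegularDistributions.

(* Main.v *)
Require Import Defs.
From mathcomp Require Import all_boot all_order all_algebra.
From mathcomp Require Import all_classical all_reals all_analysis.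
From mathcomp Require Import complex ring lra.
From mathcomp Require mpoly.
Import -(notations) mpoly.

Set Implicit Arguments.
Unset Strict Implicit.
Unset Printing Implicit Defensive.
Import Order.TTheory GRing.Theory Num.Theory.
Import numFieldNormedType.Exports.
Local Open Scope classical_set_scope.
Local Open Scope ring_scope.

(* For n = 1, transposing a_0 and a_1 onto the test function psi gives psi0 and
   psi1 such that u solves the equation iff h = <u, psi1> has derivative
   - <u, psi0>. At t = 0 the two one-sided derivatives of the glued h agree,
   since they only depend on u_1(0) = u_2(0); so the concatenation solves it too.
   For n >= 2, pick a real zeta with a_n(zeta) <> 0. On functions v(t) E with
   E = e^(zeta.x) the equation becomes an ordinary differential equation
   q(d/dt) v = 0 of order n. Its solution with v(0) = ... = v^(n-2)(0) = 0 and
   v^(n-1)(0) = 1 agrees with the zero solution at t = 0, but the concatenation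
   w of 0 and v satisfies q(d/dt) w = a_n(zeta) delta_0. *)

(** * Calculus of complex-valued functions *)

Section ComplexDerivatives.
Context (R : realType) (V : normedModType R).
Implicit Types (f g : V -> R[i]) (x v : V).

(** For n = 1 the concatenation itself need not be C^1. The argument survives because psi0 and psi1
    depend on psi alone: only the one pairing h has to be differentiated, and the equation expresses
    h' by a value of u. For n >= 2 the condition n >= 2 enters through v(0) = 0, without which 0 and
    v would not match at t = 0. The distribution E is an iterated one-dimensional integral of
    e^(zeta.x) psi(x), and what it needs is that partial derivatives integrate to 0. Integrating by
    parts in x_i would require moving that integral to the inside. Translation invariance is used
    instead: it passes through the iterated integrals without changing their order, and difference
    quotients approximate the derivative uniformly. Taking zeta real makes e^(zeta.x) positive, so E
    is nonzero by positivity. The condition a_n(zeta) <> 0 keeps the degree of q equal to n whatever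
    the other coefficients become, and splitting q over C reduces q(d/dt) to factors of order
    one. *)

Definition is_cderive x v f (df : R[i]) : Prop :=
  is_derive x v (fun y => complex.Re (f y)) (complex.Re df) /\
  is_derive x v (fun y => complex.Im (f y)) (complex.Im df).

Lemma cderivableP f x v : cderivable f x v -> is_cderive x v f (cderive v f x).
Proof. by move=> [f1 f2]; split; apply: DeriveDef. Qed.

Lemma is_cderiveW f x v df :
  is_cderive x v f df -> cderivable f x v /\ cderive v f x = df.
Proof.
move=> [[d1 e1] [d2 e2]]; split; first by split.
by rewrite /cderive e1 e2; case: df {e1 e2}.
Qed.

Lemma is_cderive_eq f x v df dg :
  is_cderive x v f df -> df = dg -> is_cderive x v f dg.
Proof. by move=> h <-. Qed.

Lemma is_cderive_cst x v (a : R[i]) : is_cderive x v (fun=> a) 0.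
Proof. by split; apply: is_derive_cst. Qed.

Lemma cReM (a b : R[i]) : complex.Re (a * b) =
  complex.Re a * complex.Re b - complex.Im a * complex.Im b.
Proof. by case: a b => [a b] [c d]. Qed.

Lemma cImM (a b : R[i]) : complex.Im (a * b) =
  complex.Re a * complex.Im b + complex.Im a * complex.Re b.
Proof. by case: a b => [a b] [c d]. Qed.

Lemma cReD (a b : R[i]) : complex.Re (a + b) = complex.Re a + complex.Re b.
Proof. by case: a b => [a b] [c d]. Qed.

Lemma cImD (a b : R[i]) : complex.Im (a + b) = complex.Im a + complex.Im b.
Proof. by case: a b => [a b] [c d]. Qed.

Lemma is_cderiveD f g x v df dg : is_cderive x v f df -> is_cderive x v g dg ->
  is_cderive x v (fun y => f y + g y) (df + dg).
Proof.
move=> [f1 f2] [g1 g2]; split.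
  rewrite cReD (_ : (fun y => _) = (fun y => complex.Re (f y)) +
    (fun y => complex.Re (g y))); first exact: is_deriveD.
  by apply/funext => y; rewrite cReD.
rewrite cImD (_ : (fun y => _) = (fun y => complex.Im (f y)) +
  (fun y => complex.Im (g y))); first exact: is_deriveD.
by apply/funext => y; rewrite cImD.
Qed.

Lemma is_cderiveM f g x v df dg : is_cderive x v f df -> is_cderive x v g dg ->
  is_cderive x v (fun y => f y * g y) (df * g x + f x * dg).
Proof.
move=> [f1 f2] [g1 g2]; split.
  rewrite (_ : (fun y => _) = (fun y => complex.Re (f y)) *
      (fun y => complex.Re (g y)) - (fun y => complex.Im (f y)) *
      (fun y => complex.Im (g y))); last by apply/funext => y; rewrite cReM.
  apply: is_derive_eq.
  by rewrite cReD !cReM /GRing.scale/=; ring.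
rewrite (_ : (fun y => _) = (fun y => complex.Re (f y)) *
    (fun y => complex.Im (g y)) + (fun y => complex.Im (f y)) *
    (fun y => complex.Re (g y))); last by apply/funext => y; rewrite cImM.
apply: is_derive_eq.
by rewrite cImD !cImM /GRing.scale/=; ring.
Qed.

Lemma is_cderiveZ f x v df (a : R[i]) : is_cderive x v f df ->
  is_cderive x v (fun y => a * f y) (a * df).
Proof.
move=> h; apply: is_cderive_eq (is_cderiveM (is_cderive_cst x v a) h) _.
by rewrite mul0r add0r.
Qed.

Lemma is_cderive_real (h : V -> R) x v dh : is_derive x v h dh ->
  is_cderive x v (fun y => (h y)%:C%C) (dh%:C%C).
Proof. by move=> dhx; split=> //=; exact: is_derive_cst. Qed.

End ComplexDerivatives.

Section ComplexLine.
Context (R : realType).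
Implicit Types (f g : R -> R[i]).

Lemma is_derive_continuous (f df : R -> R) :
  (forall t, is_derive t (1 : R) f (df t)) -> continuous f.
Proof.
move=> h t; apply: differentiable_continuous; apply/derivable1_diffP.
by have [] := h t.
Qed.

Lemma is_cderive_continuous f df :
  (forall t, is_cderive t (1 : R) f (df t)) -> ccontinuous f.
Proof.
move=> h; split.
  by apply: (@is_derive_continuous _ (fun t => complex.Re (df t))) => t; case: (h t).
by apply: (@is_derive_continuous _ (fun t => complex.Im (df t))) => t; case: (h t).
Qed.

Local Notation mu := (@lebesgue_measure R).

Lemma Rintegral_derivative (F f : R -> R) (a b : R) : a <= b ->
  continuous f -> (forall t, is_derive t (1 : R) F (f t)) ->
  \int[mu]_(t in `[a, b]) f t = F b - F a.
Proof.
rewrite le_eqVlt => /predU1P[->|ab] cf dF.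
  by rewrite set_itv1 Rintegral_set1 subrr.
have cF := is_derive_continuous dF.
have dF' t : derivable F t 1 by have [] := dF t.
rewrite /Rintegral (@continuous_FTC2 _ f F)//.
- exact: continuous_subspaceT.
- split.
  + by move=> t _.
  + by apply: cvg_at_right_filter; exact: cF.
  + by apply: cvg_at_left_filter; exact: cF.
- by move=> t _; rewrite derive1E; have [_ ->] := dF t.
Qed.

Lemma Rintegral_derivative_line (F f : R -> R) (A : R) : 0 <= A ->
  continuous f -> (forall t, is_derive t (1 : R) F (f t)) ->
  (forall t, A < `|t| -> f t = 0) ->
  \int[mu]_t f t = F A - F (- A).
Proof.
move=> A0 cf dF f0.
by rewrite -{1}(vanish_restrict f0) -Rintegral_mkcond (Rintegral_derivative _ cf dF)//; lra.
Qed.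

(** The integrand vanishes at 0 itself, so it is compared with f on the half-open interval from 0 to
    A before the endpoint is added. The boundary term [F 0] is what later becomes delta_0. *)
Lemma Rintegral_derivative_half (F f : R -> R) (A : R) : 0 <= A ->
  continuous f -> (forall t, is_derive t (1 : R) F (f t)) ->
  (forall t, A < `|t| -> f t = 0) ->
  \int[mu]_t (if t <= 0 then 0 else f t) = F A - F 0.
Proof.
move=> A0 cf dF f0.
rewrite -(Rintegral_derivative A0 cf dF) -Rintegral_itv_obnd_cbnd; last first.
  apply: (@integrableS _ _ _ mu `[0, A]) => //.
    by apply: subset_itvr; rewrite bnd_simp.
  apply: continuous_compact_integrable; first exact: segment_compact.
  exact: continuous_subspaceT.
rewrite [RHS]Rintegral_mkcond; apply: eq_Rintegral => t _; rewrite patchE.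
case: ifPn => t0; case: ifPn => //.
  by rewrite inE/= in_itv/= ltNge t0.
rewrite notin_setE/= in_itv/= ltNge t0/= => /negP; rewrite -ltNge => At.
by apply: f0; apply: lt_le_trans At (ler_norm _).
Qed.

End ComplexLine.

(** * Antiderivatives and linear equations of order one on the line *)

Section LineIntegrals.
Context (R : realType).
Local Notation mu := (@lebesgue_measure R).

Lemma derive_vanish (F : R -> R) (A t df : R) : (forall t, A < `|t| -> F t = 0) ->
  A < `|t| -> is_derive t (1 : R) F df -> df = 0.
Proof.
move=> F0 At [_ <-].
rewrite (@near_eq_derive _ _ _ _ (cst 0)) ?derive_cst//.
near=> s; apply: F0; near: s.
by have := @norm_continuous _ _ t; move/cvgr_gt; apply.
Unshelve. all: by end_near. Qed.

Lemma cintegral_derivative (F f : R -> R[i]) (A : R) : 0 <= A ->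
  ccontinuous f -> (forall t, is_cderive t (1 : R) F (f t)) ->
  (forall t, A < `|t| -> F t = 0) -> cintegral f = 0.
Proof.
move=> A0 [c1 c2] dF F0.
(* F is known to vanish only where |t| > A, so the endpoints are moved out to A + 1. *)
have A1 : 0 <= A + 1 by rewrite addr_ge0.
have F0' t : A + 1 < `|t| -> F t = 0 by move=> h; apply: F0; lra.
have FA : F (A + 1) = 0 by apply: F0; rewrite ger0_norm//; lra.
have FN : F (- (A + 1)) = 0 by apply: F0; rewrite normrN ger0_norm//; lra.
congr Complex.
  rewrite (Rintegral_derivative_line A1 c1 (fun t => (dF t).1)) ?FA ?FN ?subrr//.
  by move=> t At; apply: derive_vanish At (dF t).1 => s /F0' ->.
rewrite (Rintegral_derivative_line A1 c2 (fun t => (dF t).2)) ?FA ?FN ?subrr//.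
by move=> t At; apply: derive_vanish At (dF t).2 => s /F0' ->.
Qed.

(** The fundamental theorem differentiates integrals from a base point lying strictly to the left of
    x. Around x the signed integral [F] from 0 equals [G M y - G M 0], where the base point [- M] is
    to the left of both 0 and x; this also covers x <= 0. *)
Lemma antiderivative (f : R -> R) : continuous f ->
  exists F, F 0 = 0 /\ forall t, is_derive t (1 : R) F (f t).
Proof.
move=> cf.
have intf a b : mu.-integrable `[a, b] (EFin \o f).
  apply: continuous_compact_integrable; first exact: segment_compact.
  exact: continuous_subspaceT.
pose G M y := \int[mu]_(t in `[- M, y]) f t.
have dG (M x : R) : - M < x -> is_derive x (1 : R) (G M) (f x).
  move=> Mx; have x1 : x < x + 1 by rewrite ltrDl.
  have [d1 d2] := continuous_FTC1_closed x1 (intf (- M) (x + 1)) Mx (cf x).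
  by apply: DeriveDef; [exact: d1|rewrite -derive1E d2].
have split3 (a b c : R) : a <= b -> b <= c -> \int[mu]_(t in `[a, c]) f t =
    \int[mu]_(t in `[a, b]) f t + \int[mu]_(t in `[b, c]) f t.
  move=> ab bc.
  have := @Rintegral_itvB _ f (BLeft a) (BRight c) b (intf a c).
  rewrite !bnd_simp => /(_ ab bc).
  rewrite Rintegral_itv_obnd_cbnd; first by move=> <-; rewrite addrC subrK.
  apply: (@integrableS _ _ _ mu `[b, c]) => //.
  by apply: subset_itvr; rewrite bnd_simp.
pose F y := if 0 <= y then \int[mu]_(t in `[0, y]) f t
            else - \int[mu]_(t in `[y, 0]) f t.
have FG (M y : R) : 0 <= M -> - M < y -> F y = G M y - G M 0.
  move=> M0 My; rewrite /F /G; case: leP => y0.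
    by rewrite (split3 (- M) 0 y)// ?oppr_le0// addrAC subrr add0r.
  rewrite (split3 (- M) y 0); [|lra|lra].
  by rewrite opprD addrA subrr sub0r.
exists F; split; first by rewrite /F lexx set_itv1 Rintegral_set1.
move=> x; pose M := `|x| + 1.
have M0 : 0 <= M by rewrite addr_ge0.
have Mx : - M < x by move: (ler_norm (- x)); rewrite normrN /M; lra.
apply: (@near_eq_is_derive _ _ _ (fun y => G M y - G M 0)).
  by near=> y; rewrite -FG//; near: y; exact: lt_nbhsr.
have := dG M x Mx => h.
by apply: is_derive_eq; rewrite subr0.
Unshelve. all: by end_near. Qed.

Lemma cantiderivative (f : R -> R[i]) : ccontinuous f ->
  exists F, F 0 = 0 /\ forall t, is_cderive t (1 : R) F (f t).
Proof.
move=> [/antiderivative[F [F0 dF]] /antiderivative[G [G0 dG]]].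
exists (fun t => F t +i* G t)%C; split; first by rewrite F0 G0.
by move=> t; split; [exact: dF|exact: dG].
Qed.

Definition cexp (l : R[i]) (t : R) : R[i] :=
  Complex (expR (complex.Re l * t) * cos (complex.Im l * t))
          (expR (complex.Re l * t) * sin (complex.Im l * t)).

Lemma is_derive_linear (a t : R) : is_derive t (1 : R) (fun s => a * s) a.
Proof.
rewrite (_ : (fun s => _) = a *: id); last by [].
by apply: is_derive_eq; rewrite /GRing.scale/= mulr1.
Qed.

Lemma is_cderive_cexp (l : R[i]) (t : R) : is_cderive t (1 : R) (cexp l) (l * cexp l t).
Proof.
case: l => a b.
have ha := is_derive_linear a t; have hb := is_derive_linear b t.
have he : is_derive t (1 : R) (fun s => expR (a * s)) (a * expR (a * t)).
  rewrite (_ : (fun s => _) = expR \o (fun s => a * s))//.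
  by apply: is_derive_eq; rewrite mulrC.
have hc : is_derive t (1 : R) (fun s => cos (b * s)) (- (b * sin (b * t))).
  rewrite (_ : (fun s => _) = cos \o (fun s => b * s))//.
  by apply: is_derive_eq; rewrite mulNr mulrC.
have hs : is_derive t (1 : R) (fun s => sin (b * s)) (b * cos (b * t)).
  rewrite (_ : (fun s => _) = sin \o (fun s => b * s))//.
  by apply: is_derive_eq; rewrite mulrC.
split => /=.
  rewrite (_ : (fun s => _) = (fun s => expR (a * s)) * (fun s => cos (b * s)))//.
  by apply: is_derive_eq; rewrite /GRing.scale/=; ring.
rewrite (_ : (fun s => _) = (fun s => expR (a * s)) * (fun s => sin (b * s)))//.
by apply: is_derive_eq; rewrite /GRing.scale/=; ring.
Qed.

Lemma cexp0 (l : R[i]) : cexp l 0 = 1.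
Proof. by rewrite /cexp !mulr0 expR0 cos0 sin0 !mulr1 mulr0. Qed.

Lemma cexpN (l : R[i]) (t : R) : cexp l t * cexp (- l) t = 1.
Proof.
case: l => a b; rewrite /cexp /= !mulNr cosN sinN.
have h := expRxMexpNx_1 (a * t); have h2 := cos2Dsin2 (b * t).
apply/eqP; rewrite eq_complex /=; apply/andP; split; apply/eqP; last by ring.
rewrite -[RHS](mulr1 1) -{2}h2 -h; ring.
Qed.

(** Variation of constants: v(t) = e^(lt) (c + F(t)), where F' = e^(-lt) f and F(0) = 0. *)
Lemma linear_ode (l c : R[i]) (f : R -> R[i]) : ccontinuous f ->
  exists v, v 0 = c /\ forall t, is_cderive t (1 : R) v (l * v t + f t).
Proof.
move=> cf.
have ce m : ccontinuous (cexp m) by apply: (@is_cderive_continuous _ _ (fun t => m * cexp m t)) => t; exact: is_cderive_cexp.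
have [F [F0 dF]] := cantiderivative (ccontinuousM (ce (- l)) cf).
exists (fun t => cexp l t * (c + F t)); split.
  by rewrite cexp0 F0 addr0 mul1r.
move=> t; apply: is_cderive_eq.
  apply: is_cderiveM; first exact: is_cderive_cexp.
  apply: is_cderiveD; [exact: is_cderive_cst|exact: dF].
by rewrite add0r !mulrA cexpN mul1r.
Qed.

End LineIntegrals.

(** * Smooth functions and bump functions *)

Section Smoothness.
Context (R : realType) (m : nat).
Local Notation V := 'rV[R]_m.
Local Notation e_ i := (delta_mx 0 i : 'rV[R]_m).
Implicit Types (f g : V -> R[i]).

Inductive span_of (G : (V -> R[i]) -> Prop) : (V -> R[i]) -> Prop :=
| span_gen f : G f -> span_of G f
| span_comb (a : R[i]) f g :
    span_of G f -> span_of G g -> span_of G (a *: f + g).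

(* Smoothness by coinduction: it suffices that the partial derivatives of the
   generators stay in their linear span. *)
Lemma smooth_span (G : (V -> R[i]) -> Prop) :
  (forall f, G f -> ccontinuous f /\ forall i, exists2 df, span_of G df &
     forall x, is_cderive x (e_ i) f (df x)) ->
  forall f, span_of G f -> smooth f.
Proof.
move=> HG.
have Hs f : span_of G f -> ccontinuous f /\ forall i, exists2 df, span_of G df &
     forall x, is_cderive x (e_ i) f (df x).
  elim=> [{}f /HG //|a {}f g _ [cf df] _ [cg dg]]; split.
    exact: ccontinuousL.
  move=> i; have [f' sf' hf] := df i; have [g' sg' hg] := dg i.
  exists (a *: f' + g'); first exact: span_comb.
  move=> x; apply: is_cderive_eq.
    by apply: is_cderiveD; [exact: is_cderiveZ (hf x)|exact: hg].
  by [].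
move=> f sf.
have Hw w : span_of G (pderiv w f).
  elim: w => //= i w /Hs[_ /(_ i)[df sdf hdf]].
  rewrite (_ : cderive _ _ = df)//; apply/funext => x.
  by have [] := is_cderiveW (hdf x).
move=> w; have [cw dw] := Hs _ (Hw w); split=> // i x.
by have [df _ hdf] := dw i; have [] := is_cderiveW (hdf x).
Qed.

Lemma smooth_is_cderive f i x : smooth f ->
  is_cderive x (e_ i) f (pderiv [:: i] f x).
Proof. by move=> sf; apply: cderivableP; exact: (sf [::]).2. Qed.

Lemma smooth_cst (a : R[i]) : smooth (fun _ : V => a).
Proof.
apply: (@smooth_span (fun f => exists a, f = fun=> a)); last by apply: span_gen; exists a.
move=> _ [b ->]; split; first exact: ccontinuous_cst.
move=> i; exists (fun=> 0); first by apply: span_gen; exists 0.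
by move=> x; exact: is_cderive_cst.
Qed.

Lemma smoothM f g : smooth f -> smooth g -> smooth (fun x => f x * g x).
Proof.
move=> sf sg.
apply: (@smooth_span (fun h => exists f g, [/\ smooth f, smooth g & h = fun x => f x * g x]));
  last by apply: span_gen; exists f, g.
move=> _ [{}f [{}g [{}sf {}sg ->]]]; split.
  by apply: ccontinuousM; [exact: (sf [::]).1|exact: (sg [::]).1].
move=> i; exists (1 *: (fun x => pderiv [:: i] f x * g x) + (fun x => f x * pderiv [:: i] g x)).
  apply: span_comb; apply: span_gen.
    by exists (pderiv [:: i] f), g; split; [exact: smooth_pderiv|exact: sg|].
  by exists f, (pderiv [:: i] g); split; [exact: sf|exact: smooth_pderiv|].
move=> x; apply: is_cderive_eq.
  by apply: is_cderiveM; exact: smooth_is_cderive.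
by rewrite scale1r.
Qed.

Lemma smooth_prod (I : Type) (s : seq I) (F : I -> V -> R[i]) :
  (forall i, smooth (F i)) -> smooth (fun x => \prod_(i <- s) F i x).
Proof.
move=> sF; elim: s => [|i s ih].
  rewrite (_ : (fun x => _) = fun=> 1); first exact: smooth_cst.
  by apply/funext => x; rewrite big_nil.
rewrite (_ : (fun x => _) = fun x => F i x * \prod_(j <- s) F j x).
  exact: smoothM (sF i) ih.
by apply/funext => x; rewrite big_cons.
Qed.

(** The converse of [derive_line] at t = 0: both difference quotients are the same function of the
    increment. *)
Lemma is_derive_along (f : V -> R) (x v : V) (df : R) :
  is_derive (0 : R) (1 : R) (fun t : R => f (x + t *: v)) df -> is_derive x v f df.
Proof.
have E : (fun h : R => h^-1 *: (((fun s : R => f (x + s *: v)) \o shift 0) (h *: (1 : R)) - f (x + (0 : R) *: v)))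
  = (fun h : R => h^-1 *: ((f \o shift x) (h *: v) - f x)).
  apply/funext => h /=; rewrite scale0r !addr0; congr (_ *: (f _ - _)).
  by rewrite [h *: 1]mulr1 addrC.
by move=> [d <-]; apply: DeriveDef; move: d; rewrite /derivable /derive E.
Qed.

Lemma is_derive_coord (h : R -> R) (dh a s : R) (i j : 'I_m) (x : V) :
  is_derive (a + s * x 0 i) (1 : R) h dh ->
  is_derive x (e_ j) (fun y => h (a + s * y 0 i)) ((s *+ (i == j)) * dh).
Proof.
move=> hd; apply: is_derive_along.
pose k t := a + s * (x 0 i + t * (i == j)%:R).
have dk : is_derive (0 : R) (1 : R) k (s *+ (i == j)).
  rewrite (_ : k = (fun t => (s * (i == j)%:R) * t) + cst (a + s * x 0 i)).
    have hl := is_derive_linear (s * (i == j)%:R) (0 : R).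
    by apply: is_derive_eq; rewrite addr0 mulr_natr.
  by apply/funext => t; rewrite /k !fctE/=; ring.
rewrite (_ : (fun t => _) = h \o k); last first.
  by apply/funext => t; rewrite /k /= !mxE eqxx.
have k0 : k 0 = a + s * x 0 i by rewrite /k mul0r addr0.
have hd' : is_derive (k 0) (1 : R) h dh by rewrite k0.
by apply: is_derive_eq; rewrite mulrC.
Qed.

End Smoothness.

(** * The flat function e^(-1/y) and compactly supported bumps *)

Section Flat.
Context (R : realType).

(** For k = 0 this is the classical e^(-1/y), extended by 0. The extra powers of 1/y make the family
    closed under differentiation up to linear combinations, which is the form [smooth_span] asks
    for. *)
Definition flat (k : nat) (y : R) : R :=
  if y <= 0 then 0 else y^-1 ^+ k * expR (- y^-1).

Lemma flat_ge0 k y : 0 <= flat k y.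
Proof.
rewrite /flat; case: (leP y 0) => // y0.
by rewrite mulr_ge0 ?expR_ge0// exprn_ge0// invr_ge0 ltW.
Qed.

Lemma flat_gt0 k y : 0 < y -> 0 < flat k y.
Proof.
by move=> y0; rewrite /flat leNgt y0/= mulr_gt0 ?expR_gt0// exprn_gt0// invr_gt0.
Qed.

Lemma flat_le0 k y : y <= 0 -> flat k y = 0.
Proof. by rewrite /flat => ->. Qed.

(** With z = 1/y this is e^z >= z^(k+2) / (k+2)!, one term of the exponential series. A quadratic
    bound is enough for the derivative at 0 to exist and vanish. *)
Lemma flat_sqr k y : `|flat k y| <= (k.+2)`!%:R * y ^+ 2.
Proof.
rewrite ger0_norm ?flat_ge0// /flat; case: (leP y 0) => y0.
  by rewrite mulr_ge0 ?ler0n// sqr_ge0.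
have z0 : 0 < y^-1 by rewrite invr_gt0.
rewrite -[y in leRHS](invrK y); move: (y^-1) z0 => z z0.
have h := @expR_ge1Dxn _ z k.+1 (ltW z0).
rewrite expRN exprVn ler_pdivrMr ?expR_gt0//.
rewrite [leRHS]mulrAC ler_pdivlMr ?exprn_gt0// -exprD addn2.
have f0 : (0 : R) < (k.+2)`!%:R by rewrite ltr0n fact_gt0.
rewrite mulrC -ler_pdivrMr//; lra.
Qed.

Lemma is_derive_sqr_bound (f : R -> R) (C : R) : (forall y, `|f y| <= C * y ^+ 2) ->
  is_derive (0 : R) (1 : R) f 0.
Proof.
move=> fC.
have f0 : f 0 = 0.
  by apply/eqP; rewrite -normr_le0 (le_trans (fC 0))// expr0n mulr0.
have C0 : 0 <= C by have := fC 1; rewrite expr1n mulr1; apply: le_trans.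
have key : (fun h => h^-1 *: ((f \o shift 0) (h *: (1 : R)) - f 0)) @ 0^' --> (0 : R).
  apply/cvgrPdist_le => e e0.
  have e' : 0 < e / (C + 1) by rewrite divr_gt0// ltr_wpDl.
  near=> h => /=.
  have h0 : h != 0 by near: h; exact: nbhs_dnbhs_neq.
  have he : `|h| <= e / (C + 1).
    near: h; apply: nbhs_dnbhs; apply/nbhs_ballP; exists (e / (C + 1)) => //= y.
    by rewrite /ball/= sub0r normrN => /ltW.
  rewrite sub0r normrN f0 subr0 addr0 [h *: 1]mulr1 normrZ normfV.
  rewrite ler_pdivrMl ?normr_gt0// (le_trans (fC h))// -real_normK ?num_real//.
  rewrite expr2 mulrA [C * _]mulrC -mulrA ler_wpM2l// .
  apply: (@le_trans _ _ (C * (e / (C + 1)))); first by rewrite ler_wpM2l.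
  by rewrite mulrCA ger_pMr// ler_pdivrMr; lra.
apply: DeriveDef; first by apply/cvg_ex; exists 0.
exact: cvg_lim key.
Unshelve. all: by end_near. Qed.

Lemma is_derive_flat k (y : R) :
  is_derive y (1 : R) (flat k) (flat k.+2 y - k%:R * flat k.+1 y).
Proof.
have [y0|y0|->] := ltgtP y 0.
- rewrite !flat_le0 ?(ltW y0)// mulr0 subr0.
  apply: (@near_eq_is_derive _ _ _ (cst 0)).
  by near=> z; rewrite flat_le0//; near: z; exact: lt_le_nbhsl.
- pose g z : R := z^-1 ^+ k * expR (- z^-1).
  apply: (@near_eq_is_derive _ _ _ g).
    near=> z; rewrite /flat ifF//; apply/negbTE; rewrite -ltNge; near: z.
    exact: lt_nbhsr.
  have dV : is_derive y (1 : R) (fun z => z^-1) (- y^-1 ^+ 2).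
    have y0' : y != 0 by rewrite gt_eqF.
    have := @is_deriveV _ id y 1 1 y0' (is_derive_id _ _).
    by rewrite /GRing.scale/= mulr1 exprVn.
  have dE : is_derive y (1 : R) (fun z => expR (- z^-1)) (y^-1 ^+ 2 * expR (- y^-1)).
    rewrite (_ : (fun z => _) = expR \o (- (fun z => z^-1)))//.
    by apply: is_derive_eq; rewrite opprK mulrC.
  rewrite (_ : g = (fun z => z^-1) ^+ k * (fun z => expR (- z^-1))); last first.
    by apply/funext => z; rewrite /g !fctE.
  apply: is_derive_eq.
  rewrite /flat leNgt y0/= /GRing.scale/= !fctE.
  case: k {g} => [|k]; first by rewrite /=; ring.
  by rewrite /= !exprS; ring.
- rewrite !flat_le0// mulr0 subr0.
  by apply: is_derive_sqr_bound; exact: flat_sqr.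
Unshelve. all: by end_near. Qed.

Context (m : nat).
Local Notation V := 'rV[R]_m.

Lemma smooth_flat_coord (a s : R) (i : 'I_m) :
  smooth (fun x : V => (flat 0 (a + s * x 0 i))%:C%C).
Proof.
pose F k (x : V) := (flat k (a + s * x 0 i))%:C%C.
(* In [a *: f + g] the last term has no coefficient, so the generators carry scalars of their
   own. *)
apply: (@smooth_span _ _ (fun f => exists c k, f = c *: F k)); last first.
  by apply: span_gen; exists 1, 0%N; rewrite scale1r.
have dF k (x : V) j : is_cderive x (delta_mx 0 j) (F k)
   ((s *+ (i == j) * (flat k.+2 (a + s * x 0 i) - k%:R * flat k.+1 (a + s * x 0 i)))%:C%C).
  apply: is_cderive_real.
  apply: (@is_derive_coord _ _ (flat k)).
  exact: is_derive_flat.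
have cF k : ccontinuous (F k).
  split; last exact: cst_continuous.
  move=> x; apply: (@continuous_comp _ _ _ (fun y : V => a + s * y 0 i) (flat k)).
    move: x; apply: cont_add; first exact: cst_continuous.
    by apply: cont_mul; [exact: cst_continuous|exact: coord_continuous].
  by apply: (@is_derive_continuous _ _ (fun y => flat k.+2 y - k%:R * flat k.+1 y)) => t;
    exact: is_derive_flat.
move=> _ [c [k ->]]; split.
  by rewrite -[_ *: _]addr0; apply: ccontinuousL => //; exact: ccontinuous_cst.
move=> j; pose b := (s *+ (i == j))%:C%C.
exists ((c * b) *: (1 *: F k.+2) + (- (c * b * k%:R)) *: F k.+1).
  apply: span_comb; apply: span_gen; first by exists 1, k.+2.
  by exists (- (c * b * k%:R)), k.+1.
move=> x; apply: is_cderive_eq; first exact: is_cderiveZ (dF k x j).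
rewrite -[RHS]/((c * b) * (1 * F k.+2 x) + (- (c * b * k%:R)) * F k.+1 x).
rewrite /F rmorphM rmorphB rmorphM/= rmorph_nat -/b; ring.
Qed.

(** Coordinate i contributes flat(e - (x_i - c_i)) flat(e + (x_i - c_i)), which is positive exactly
    when |x_i - c_i| < e. The real function [b] is kept beside [beta] for sign arguments. *)
Lemma exists_bump (c : V) (e : R) : 0 < e -> exists (b : V -> R) (beta : testfun R m),
  [/\ forall x, beta x = (b x)%:C%C, forall x, 0 <= b x, 0 < b c &
      forall (x : V) i, e <= `|x 0 i - c 0 i| -> b x = 0].
Proof.
move=> e0.
pose b (x : V) := \prod_i (flat 0 ((e + c 0 i) + (- 1) * x 0 i) *
                           flat 0 ((e - c 0 i) + 1 * x 0 i)).
have b0 (x : V) i : e <= `|x 0 i - c 0 i| -> b x = 0.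
  move=> h; rewrite /b (bigD1 i)//=.
  suff -> : flat 0 ((e + c 0 i) + (- 1) * x 0 i) * flat 0 ((e - c 0 i) + 1 * x 0 i) = 0.
    by rewrite mul0r.
  have [h1|h1] := leP 0 (x 0 i - c 0 i).
    by rewrite (ger0_norm h1) in h; rewrite flat_le0 ?mul0r//; lra.
  by rewrite (ltr0_norm h1) in h; rewrite mulrC flat_le0 ?mul0r//; lra.
have sb : smooth (fun x : V => (b x)%:C%C).
  rewrite (_ : (fun x => _) = (fun x : V => \prod_i
      ((flat 0 ((e + c 0 i) + (- 1) * x 0 i))%:C%C *
       (flat 0 ((e - c 0 i) + 1 * x 0 i))%:C%C))).
    by apply: smooth_prod => i; apply: smoothM; exact: smooth_flat_coord.
  by apply/funext => x; rewrite /b rmorph_prod; apply: eq_bigr => i _; rewrite rmorphM.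
have Tb : test_pred (fun x : V => (b x)%:C%C).
  apply/asboolP; split=> //.
  apply: (@compact_suppL _ _ [set x : V | forall i, `[c 0 i - e, c 0 i + e]%classic (x ord0 i)]).
    apply: (@rV_compact R m (fun i => `[c 0 i - e, c 0 i + e]%classic)) => i.
    exact: segment_compact.
  move=> x /existsNP[i /=]; rewrite in_itv/= => /negP h.
  rewrite (b0 x i)//; move: h; rewrite negb_and -!ltNge => /orP[h|h].
    by rewrite distrC; apply: le_trans (ler_norm _); lra.
  by apply: le_trans (ler_norm _); lra.
exists b, (TestFun Tb); split=> //.
  by move=> x; apply: prodr_ge0 => i _; rewrite mulr_ge0// flat_ge0.
apply: prodr_gt0 => i _; rewrite mulr_gt0// flat_gt0//; lra.
Qed.

End Flat.

(** * Weak derivatives and gluing on the line *)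

Section TestFunctionsOnTheLine.
Context (R : realType).
Local Notation mu := (@lebesgue_measure R).

Lemma testfun_line_derive (phi : testfun R 1) (t : R) :
  is_cderive t (1 : R) (fun s => phi (const_mx s)) (tpartial ord0 phi (const_mx t)).
Proof.
have E (s : R) : const_mx s = 0 + s *: delta_mx 0 ord0 :> 'rV[R]_1.
  by apply/matrixP => i j; rewrite !mxE !ord1 eqxx mulr1 add0r.
rewrite (_ : (fun s : R => phi (const_mx s)) = fun s => phi (0 + s *: delta_mx 0 ord0)); last first.
  by apply/funext => s; rewrite E.
rewrite E /=.
have [d1 d2] := (testfun_smooth phi [::]).2 ord0 (0 + t *: delta_mx 0 ord0).
split; first exact: (derive_line d1).
exact: (derive_line d2).
Qed.

Lemma Rintegral_gt0 (f : R -> R) (A c : R) : continuous f ->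
  (forall t, A < `|t| -> f t = 0) -> (forall t, 0 <= f t) -> 0 < f c ->
  0 < \int[mu]_t f t.
Proof.
move=> cf f0 fge fc.
have fc2 : 0 < f c / 2 by rewrite divr_gt0.
have /cvgrPdist_le /(_ _ fc2) /nbhs_ballP[d /= d0 Hd] := cf c.
pose e := d / 2; have e0 : 0 < e by rewrite divr_gt0.
have He t : c - e <= t <= c + e -> f c / 2 <= f t.
  move=> te; have : `|f c - f t| <= f c / 2.
    by apply: Hd; rewrite /ball/= ltr_norml /e in te *; lra.
  rewrite ler_norml; lra.
apply: (@lt_le_trans _ _ (\int[mu]_(t in `[c - e, c + e]) cst (f c / 2) t)).
  have -> : \int[mu]_(t in `[c - e, c + e]) cst (f c / 2) t =
      f c / 2 * fine (mu `[c - e, c + e]) by apply: Rintegral_cst.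
  rewrite lebesgue_measure_itv/= lte_fin ifT /=; last by lra.
  by rewrite mulr_gt0//; lra.
rewrite Rintegral_mkcond; apply: le_Rintegral => //.
- rewrite -restrict_EFin; apply/(integrable_mkcond _ _).1 => //.
  apply: continuous_compact_integrable; first exact: segment_compact.
  by apply: continuous_subspaceT; exact: cst_continuous.
- exact: vanish_integrable f0.
- move=> t _; rewrite patchE; case: ifPn => // /set_mem /=; rewrite in_itv/=.
  exact: He.
Qed.

(** Multiplying f by the conjugate [a] of f(c) makes the real part at c equal to |f(c)|^2. Were it
    positive, it would stay positive near c, and a bump supported there would give a positive
    integral. *)
Lemma fundamental_lemma (f : R -> R[i]) : ccontinuous f ->
  (forall phi : testfun R 1, cintegral (fun t : R => phi (const_mx t) * f t) = 0) ->
  forall t, f t = 0.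
Proof.
move=> cf f0 c.
have cpf (phi : testfun R 1) : ccontinuous (fun t : R => phi (const_mx t) * f t).
  by apply: ccontinuousM => //; exact: testfun_line.
pose a : R[i] := Complex (complex.Re (f c)) (- complex.Im (f c)).
have caf : ccontinuous (fun t : R => a * f t).
  by apply: ccontinuousM => //; exact: ccontinuous_cst.
have af0 (phi : testfun R 1) : cintegral (fun t : R => phi (const_mx t) * (a * f t)) = 0.
  have [A [A0 HA]] := testfun_line_supp phi.
  have v0 t : A < `|t| -> phi (const_mx t) * f t = 0 by move=> /HA ->; rewrite mul0r.
  (* Writing a g as (a - 1) g + g turns scaling into an instance of [cintegralL]; the same device
     returns below. *)
  rewrite (_ : (fun t => _) = fun t : R => (a - 1) * (phi (const_mx t) * f t) + phi (const_mx t) * f t).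
    by rewrite (cintegralL _ (cpf phi) (cpf phi) v0 v0) f0 mulr0 addr0.
  by apply/funext => t; ring.
suff : complex.Re (a * f c) <= 0.
  rewrite cReM /= mulNr opprK => h.
  have := sqr_ge0 (complex.Re (f c)); have := sqr_ge0 (complex.Im (f c)).
  rewrite !expr2 => h1 h2.
  have e1 : complex.Re (f c) * complex.Re (f c) = 0 by lra.
  have e2 : complex.Im (f c) * complex.Im (f c) = 0 by lra.
  move/eqP: e1; move/eqP: e2; rewrite !mulf_eq0 !orbb => /eqP e2 /eqP e1.
  by move: e1 e2; case: (f c) => /= x y -> ->.
rewrite leNgt; apply/negP => pos.
have cg := caf.1; set g := (fun x => complex.Re _) in cg.
have /cvgr_gt /(_ _ pos) /nbhs_ballP[e /= e0 He] := cg c.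
have [b [beta [bE b0 bc bout]]] := exists_bump (const_mx c : 'rV[R]_1) e0.
have := congr1 (@complex.Re R) (af0 beta); rewrite /= => hint.
suff : 0 < \int[mu]_t complex.Re (beta (const_mx t) * (a * f t)) by rewrite hint ltxx.
have E t : complex.Re (beta (const_mx t) * (a * f t)) = b (const_mx t) * g t.
  by rewrite bE cReM /= mul0r subr0.
have [A [A0 HA]] := testfun_line_supp beta.
apply: (@Rintegral_gt0 _ A c).
- by have [] := ccontinuousM (testfun_line beta) caf.
- by move=> t /HA ->; rewrite mul0r.
- move=> t; rewrite E; have [h|h] := ltP `|t - c| e.
    by rewrite mulr_ge0// ltW//; apply: He; rewrite /ball/= distrC.
  by rewrite (bout _ ord0) ?mul0r// !mxE.
- by rewrite E mulr_gt0.
Qed.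

(** Integration by parts: (phi h)' has integral 0, so the pairing on the left is the integral of phi
    (g + h'), and the fundamental lemma decides when this vanishes for every phi. *)
Lemma weak_derivative (g h h' : R -> R[i]) : ccontinuous g -> ccontinuous h' ->
  (forall t, is_cderive t (1 : R) h (h' t)) ->
  (forall phi : testfun R 1, cintegral (fun t : R =>
     phi (const_mx t) * g t - tpartial ord0 phi (const_mx t) * h t) = 0) <->
  (forall t, h' t = - g t).
Proof.
move=> cg ch' dh; have ch := is_cderive_continuous dh.
have dph (phi : testfun R 1) t := is_cderiveM (testfun_line_derive phi t) (dh t).
have cph (phi : testfun R 1) : ccontinuous (fun t : R =>
    tpartial ord0 phi (const_mx t) * h t + phi (const_mx t) * h' t).
  rewrite (_ : (fun t => _) = fun t : R => 1 * (tpartial ord0 phi (const_mx t) * h t) + phi (const_mx t) * h' t).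
    apply: ccontinuousL; apply: ccontinuousM => //; exact: testfun_line.
  by apply/funext => t; rewrite mul1r.
have zph (phi : testfun R 1) : cintegral (fun t : R =>
    tpartial ord0 phi (const_mx t) * h t + phi (const_mx t) * h' t) = 0.
  have [A [A0 HA]] := testfun_line_supp phi.
  apply: (@cintegral_derivative _ _ _ A A0 (cph phi) (dph phi)).
  by move=> t /HA ->; rewrite mul0r.
split=> [weak t|E phi].
  suff : g t + h' t = 0 by move=> /eqP; rewrite addrC addr_eq0 => /eqP.
  have cgh : ccontinuous (fun t : R => g t + h' t).
    rewrite (_ : (fun t => _) = fun t : R => 1 * g t + h' t); first exact: ccontinuousL.
    by apply/funext => s; rewrite mul1r.
  move: t; apply: fundamental_lemma => // phi.
  have [A [A0 HA]] := testfun_line_supp phi.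
  have [B [B0 HB]] := testfun_line_supp (tpartial ord0 phi).
  have HAm t : Num.max A B < `|t| -> phi (const_mx t) = 0 /\ tpartial ord0 phi (const_mx t) = 0.
    by rewrite gt_max => /andP[/HA ? /HB ?].
  rewrite (_ : (fun t => _) = fun t : R => 1 * (phi (const_mx t) * g t - tpartial ord0 phi (const_mx t) * h t)
     + (tpartial ord0 phi (const_mx t) * h t + phi (const_mx t) * h' t)).
    rewrite (@cintegralL _ _ _ _ (Num.max A B)) ?weak ?zph ?mulr0 ?addr0//.
    - rewrite (_ : (fun t => _) = fun t : R => (-1) * (tpartial ord0 phi (const_mx t) * h t) + phi (const_mx t) * g t).
        apply: ccontinuousL; apply: ccontinuousM => //; exact: testfun_line.
      by apply/funext => t; rewrite mulN1r addrC.
    - by move=> t /HAm[-> ->]; rewrite !mul0r subr0.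
    - by move=> t /HAm[-> ->]; rewrite !mul0r addr0.
  by apply/funext => t; ring.
rewrite (_ : (fun t => _) = fun t : R => (-2) * (tpartial ord0 phi (const_mx t) * h t + phi (const_mx t) * h' t)
   + (tpartial ord0 phi (const_mx t) * h t + phi (const_mx t) * h' t)); last first.
  by apply/funext => t; rewrite E; ring.
have [A [A0 HA]] := testfun_line_supp phi.
have [B [B0 HB]] := testfun_line_supp (tpartial ord0 phi).
have v0 t : Num.max A B < `|t| -> tpartial ord0 phi (const_mx t) * h t + phi (const_mx t) * h' t = 0.
  by rewrite gt_max => /andP[/HA -> /HB ->]; rewrite !mul0r addr0.
by rewrite (cintegralL _ (cph phi) (cph phi) v0 v0) zph mulr0 addr0.
Qed.

(** At 0, because [h1 0 = h2 0], each difference quotient of the glued function is the quotient of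
    [h1] or of [h2] for the same increment, and both tend to [d1 0]. *)
Lemma is_derive_glue (h1 h2 d1 d2 : R -> R) :
  (forall t, is_derive t (1 : R) h1 (d1 t)) ->
  (forall t, is_derive t (1 : R) h2 (d2 t)) -> h1 0 = h2 0 -> d1 0 = d2 0 ->
  forall t, is_derive t (1 : R) (fun s : R => if s <= 0 then h1 s else h2 s)
    (if t <= 0 then d1 t else d2 t).
Proof.
move=> D1 D2 h0 d0 t; have [t0|t0|->] := ltgtP t 0.
- rewrite ?(ltW t0); apply: near_eq_is_derive (D1 t).
  by near=> s; rewrite ifT//; near: s; exact: lt_le_nbhsl.
- apply: near_eq_is_derive (D2 t).
  by near=> s; rewrite ifF//; apply/negbTE; rewrite -ltNge; near: s; exact: lt_nbhsr.
- set F := fun s => _.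
  have key : (fun h => h^-1 *: ((F \o shift 0) (h *: (1 : R)) - F 0)) @ 0^' --> d1 0.
    apply/cvgrPdist_le => e e0.
    have [c1 v1] := D1 0; have [c2 v2] := D2 0.
    have /cvgrPdist_le /(_ _ e0) := c1; rewrite -/(derive h1 0 1) v1 => H1.
    have /cvgrPdist_le /(_ _ e0) := c2; rewrite -/(derive h2 0 1) v2 -d0 => H2.
    near=> h; rewrite /F /= lexx; case: ifPn => _.
      by near: h.
    by rewrite h0; near: h.
  apply: DeriveDef; first by apply/cvg_ex; exists (d1 0).
  exact: cvg_lim key.
Unshelve. all: by end_near. Qed.

Lemma is_cderive_glue (h1 h2 d1 d2 : R -> R[i]) :
  (forall t, is_cderive t (1 : R) h1 (d1 t)) ->
  (forall t, is_cderive t (1 : R) h2 (d2 t)) -> h1 0 = h2 0 -> d1 0 = d2 0 ->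
  forall t, is_cderive t (1 : R) (fun s : R => if s <= 0 then h1 s else h2 s)
    (if t <= 0 then d1 t else d2 t).
Proof.
move=> D1 D2 h0 d0 t; split.
  rewrite (fun_if (@complex.Re R)).
  rewrite (_ : (fun s => _) = fun s : R => if s <= 0 then complex.Re (h1 s) else complex.Re (h2 s)).
    apply: (@is_derive_glue _ _ (fun t => complex.Re (d1 t)) (fun t => complex.Re (d2 t))).
    - by move=> s; exact: (D1 s).1.
    - by move=> s; exact: (D2 s).1.
    - by rewrite h0.
    - by rewrite d0.
  by apply/funext => s; case: ifP.
rewrite (fun_if (@complex.Im R)).
rewrite (_ : (fun s => _) = fun s : R => if s <= 0 then complex.Im (h1 s) else complex.Im (h2 s)).
  apply: (@is_derive_glue _ _ (fun t => complex.Im (d1 t)) (fun t => complex.Im (d2 t))).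
  - by move=> s; exact: (D1 s).2.
  - by move=> s; exact: (D2 s).2.
  - by rewrite h0.
  - by rewrite d0.
by apply/funext => s; case: ifP.
Qed.

Lemma continuous_glue (h1 h2 : R -> R) : continuous h1 -> continuous h2 ->
  h1 0 = h2 0 -> continuous (fun s : R => if s <= 0 then h1 s else h2 s).
Proof.
move=> c1 c2 h0 t; have [t0|t0|->] := ltgtP t 0.
- rewrite /continuous_at (ltW t0).
  apply: (cvg_trans _ (c1 t)); apply: near_eq_cvg.
  by near=> s; rewrite ifT//; near: s; exact: lt_le_nbhsl.
- rewrite /continuous_at (lt_geF t0).
  apply: (cvg_trans _ (c2 t)); apply: near_eq_cvg.
  by near=> s; rewrite ifF//; apply/negbTE; rewrite -ltNge; near: s; exact: lt_nbhsr.
- rewrite /continuous_at lexx; apply/cvgrPdist_le => e e0.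
  have /cvgrPdist_le /(_ _ e0) H1 := c1 0.
  have /cvgrPdist_le /(_ _ e0) H2 := c2 0.
  near=> s; case: ifPn => _; first by near: s.
  by rewrite h0; near: s.
Unshelve. all: by end_near. Qed.

Lemma ccontinuous_glue (h1 h2 : R -> R[i]) : ccontinuous h1 -> ccontinuous h2 ->
  h1 0 = h2 0 -> ccontinuous (fun s : R => if s <= 0 then h1 s else h2 s).
Proof.
move=> [c1 c1'] [c2 c2'] h0; split.
  rewrite (_ : (fun s => _) = fun s : R => if s <= 0 then complex.Re (h1 s) else complex.Re (h2 s)).
    by apply: continuous_glue => //; rewrite h0.
  by apply/funext => s; case: ifP.
rewrite (_ : (fun s => _) = fun s : R => if s <= 0 then complex.Im (h1 s) else complex.Im (h2 s)).
  by apply: continuous_glue => //; rewrite h0.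
by apply/funext => s; case: ifP.
Qed.

End TestFunctionsOnTheLine.

(** * Operators of order one *)

Section Transposition.
Context (R : realType) (d : nat).

(** The order of quantifiers matters: psi' is chosen before T, hence serves all the values u(t) at
    once. *)
Definition transposable (P : distr R d -> distr R d) : Prop :=
  forall psi, exists psi', forall T, P T psi = T psi'.

Lemma transposable_iter (P : distr R d -> distr R d) n :
  transposable P -> transposable (iter n P).
Proof.
move=> tP; elim: n => [|n ih] psi; first by exists psi.
have [psi1 E1] := tP psi; have [psi2 E2] := ih psi1.
by exists psi2 => T; rewrite /= E1 E2.
Qed.

Lemma transposable_dpartial (i : 'I_d) : transposable (dpartial i).
Proof.
move=> psi; exists ((-1) *: tpartial i psi) => T.
by rewrite distrZ mulN1r.
Qed.

Lemma transposable_dmonomial k : transposable (@dmonomial R d k).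
Proof.
rewrite /dmonomial; elim: (enum _) => [|i s ih] psi; first by exists psi.
have [psi1 E1] := transposable_iter (k i) (transposable_dpartial i) psi.
have [psi2 E2] := ih psi1.
by exists psi2 => T; rewrite /= E1 E2.
Qed.

Lemma transposable_dpolynomial (a : mpoly d R[i]) : transposable (dpolynomial a).
Proof.
rewrite /dpolynomial => psi; elim: (msupp a) => [|k s [psi2 E2]].
  exists 0 => T; rewrite big_nil.
  by have := distrZ T 0 0; rewrite scale0r mul0r => ->.
have [psi1 E1] := transposable_dmonomial k psi.
exists (mcoeff k a *: psi1 + psi2) => T.
by rewrite big_cons distrLE E1 E2 distrL.
Qed.

Lemma vdistr_sumE (n : nat) (U : 'I_n -> vdistr R d) phi psi :
  (\sum_(k < n) U k) phi psi = \sum_(k < n) U k phi psi.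
Proof. exact: (big_morph (fun W : vdistr R d => W phi psi)). Qed.

Lemma iter_vderivE (U : vdistr R d) k phi :
  iter k (@vderiv R d) U phi = (-1) ^+ k *: U (iter k (@tpartial R 1 ord0) phi).
Proof.
elim: k phi => [|k ih] phi; first by rewrite expr0 scale1r.
rewrite -[LHS]/(- (iter k (@vderiv R d) U (tpartial ord0 phi))) ih -iterSr.
by rewrite exprS -scalerA scaleN1r.
Qed.

Lemma DopE (p : {poly mpoly d R[i]}) (U : vdistr R d) phi psi :
  Dop p U phi psi = \sum_(k < size p) dpolynomial p`_k
    ((-1) ^+ k *: U (iter k (@tpartial R 1 ord0) phi)) psi.
Proof.
rewrite /Dop vdistr_sumE; apply: eq_bigr => k _.
by rewrite -iter_vderivE.
Qed.

Lemma vdistr_eq0 (U : vdistr R d) :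
  U = 0 <-> forall phi psi, U phi psi = 0.
Proof.
split=> [-> //|U0]; apply/val_inj/funext => phi.
by apply: distr_eq => psi; exact: U0.
Qed.

End Transposition.

Section FirstOrder.
Context (R : realType) (d : nat).

(** Since psi0 and psi1 are fixed before u and phi, the same pair tests u1, u2 and their
    concatenation. *)
Lemma Dop_first_order (p : {poly mpoly d R[i]}) : size p = 2%N ->
  forall psi, exists psi0 psi1, forall (u : R -> distr R d) (cu : dcontinuous u) phi,
  Dop p (regular cu) phi psi = cintegral (fun t : R =>
    phi (const_mx t) * u t psi0 - tpartial ord0 phi (const_mx t) * u t psi1).
Proof.
move=> sp psi.
have [psi0 E0] := transposable_dpolynomial p`_0 psi.
have [psi1 E1] := transposable_dpolynomial p`_1 psi.
exists psi0, psi1 => u cu phi; rewrite DopE sp !big_ord_recl big_ord0 addr0 /= expr0 scale1r expr1.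
rewrite E0 E1 scaleN1r -[X in _ + X]/(- regular cu (tpartial ord0 phi) psi1) !regularE.
have [A [A0 HA]] := testfun_line_supp phi.
have [B [B0 HB]] := testfun_line_supp (tpartial ord0 phi).
rewrite -mulN1r addrC -(@cintegralL _ _ _ _ (Num.max A B)); try exact: pair_cont.
- by congr cintegral; apply/funext => t; rewrite mulN1r addrC.
- by move=> t; rewrite gt_max => /andP[_ /HB ->]; rewrite mul0r.
- by move=> t; rewrite gt_max => /andP[/HA -> _]; rewrite mul0r.
Qed.

Lemma concatenation_continuous (u1 u2 : R -> distr R d) :
  dcontinuous u1 -> dcontinuous u2 -> u1 0 = u2 0 ->
  dcontinuous (concatenation u1 u2).
Proof.
move=> c1 c2 u0 psi.
rewrite (_ : (fun t => _) = fun t : R => if t <= 0 then u1 t psi else u2 t psi).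
  by apply: ccontinuous_glue; [exact: c1|exact: c2|rewrite u0].
by apply/funext => t; rewrite /concatenation; case: ifP.
Qed.

(** [weak_derivative] is used in both directions: it extracts h' = - <u, psi0> from each of the two
    solutions, and turns the same identity for the glued h back into the equation. The
    differentiability of the glued h comes from [is_cderive_glue], not from the concatenation being
    C^1. *)
Lemma concatenable_first_order (p : {poly mpoly d R[i]}) : size p = 2%N ->
  concatenable (solution_set p).
Proof.
move=> sp u1 u2 [c1 S1] C1 [c2 S2] C2 u0.
exists (concatenation_continuous c1 c2 u0).
apply/vdistr_eq0 => phi psi.
have [psi0 [psi1 E]] := Dop_first_order sp psi.
have D (u : R -> distr R d) (cu : dcontinuous u) : dC1 u -> Dop p (regular cu) = 0 ->
    forall t, is_cderive t (1 : R) (fun s => u s psi1) (- u t psi0).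
  move=> Cu Su t; have dh (s : R) := cderivableP ((Cu psi1).1 s).
  apply: is_cderive_eq (dh t) _; move: t.
  by apply/(weak_derivative (cu psi0) (Cu psi1).2 dh) => phi'; rewrite -(E _ cu) Su.
rewrite E; move: phi.
have dh : forall t, is_cderive t (1 : R) (fun s => concatenation u1 u2 s psi1)
    (- concatenation u1 u2 t psi0).
  have := is_cderive_glue (D _ c1 C1 S1) (D _ c2 C2 S2).
  rewrite u0 => /(_ erefl erefl) h t.
  move: (h t); rewrite (_ : (fun s => _) = fun s => concatenation u1 u2 s psi1).
    by move/is_cderive_eq; apply; rewrite /concatenation; case: ifP.
  by apply/funext => s; rewrite /concatenation; case: ifP.
have cc := concatenation_continuous c1 c2 u0 psi0.
have cN : ccontinuous (fun t : R => - concatenation u1 u2 t psi0).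
  rewrite (_ : (fun t => _) = fun t : R => (-1) * concatenation u1 u2 t psi0).
    by apply: ccontinuousM => //; exact: ccontinuous_cst.
  by apply/funext => t; rewrite mulN1r.
by apply/(weak_derivative cc cN dh).
Qed.

End FirstOrder.

(** * Iterated integrals *)

Section IteratedIntegrals.
Context (R : realType) (d : nat).
Local Notation V := 'rV[R]_d.
Local Notation mu := (@lebesgue_measure R).
Implicit Types (f g : V -> R[i]) (x : V) (i j : 'I_d) (l : seq 'I_d).

Definition upd i (s : R) x : V := \row_j (if j == i then s else x 0 j).

Lemma updE i s x j : upd i s x 0 j = if j == i then s else x 0 j.
Proof. by rewrite mxE. Qed.

Lemma upd_upd i s s' x : upd i s (upd i s' x) = upd i s x.
Proof. by apply/rowP => j; rewrite !updE; case: eqP. Qed.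

Lemma updC i j s t x : j != i -> upd i s (upd j t x) = upd j t (upd i s x).
Proof.
move=> /eqP ji; apply/rowP => k; rewrite !updE.
by case: eqP => [->|//]; case: eqP => // e; case: ji.
Qed.

Lemma upd_id i x : upd i (x 0 i) x = x.
Proof. by apply/rowP => j; rewrite updE; case: eqP => [->|]. Qed.

Lemma upd_shift i x h : upd i (x 0 i + h) x = x + h *: delta_mx 0 i.
Proof.
apply/rowP => j; rewrite updE !mxE eqxx /=.
by case: eqP => [->|_]; rewrite ?mulr1 ?mulr0 ?addr0.
Qed.

Lemma upd_sub i a b x : upd i a x = upd i b x + (a - b) *: delta_mx 0 i.
Proof.
rewrite -upd_shift updE eqxx upd_upd; congr upd; ring.
Qed.

(* The coordinates outside l are those already integrated out. A Lipschitz bound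
   in each coordinate survives integration in another one without any appeal to
   uniform continuity, and suffices for the slices to be continuous. *)
Definition box_fun l (A M : R) f : Prop :=
  [/\ 0 <= A, 0 <= M,
      forall x i a b, normc (f (upd i a x) - f (upd i b x)) <= M * `|a - b| &
      forall x j, j \in l -> A < `|x 0 j| -> f x = 0].

Lemma cintegral0 : cintegral (fun=> 0 : R[i]) = 0 :> R[i].
Proof.
apply: (@cintegral_derivative _ (fun=> 0) _ 0) => //; first exact: ccontinuous_cst.
by move=> t; exact: is_cderive_cst.
Qed.

(** The result stays a function on the whole space, constant in coordinate i, so that every stage of
    the iteration has the same type. *)
Definition pint i f x : R[i] := cintegral (fun s => f (upd i s x)).

Definition iint l f : V -> R[i] := foldl (fun g i => pint i g) f l.

Lemma box_fun_slice l A M f i x : box_fun l A M f ->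
  ccontinuous (fun s : R => f (upd i s x)).
Proof.
move=> [_ M0 lip _].
have key (k : R -> R) : (forall a b, `|k a - k b| <= M * `|a - b|) -> continuous k.
  move=> H t; apply/cvgrPdist_le => e e0.
  have e' : 0 < e / (M + 1) by rewrite divr_gt0// ltr_wpDl.
  apply/nbhs_ballP; exists (e / (M + 1)) => //= s; rewrite /ball/= => ts.
  apply: le_trans (H t s) _; apply: (@le_trans _ _ (M * (e / (M + 1)))).
    by rewrite ler_wpM2l// ltW.
  by rewrite mulrCA ger_pMr// ler_pdivrMr; lra.
split; apply: key => a b; apply: le_trans (lip x i a b).
  by rewrite (le_trans _ (normc_Re _))//; case: (f _) (f _) => [? ?] [? ?].
by rewrite (le_trans _ (normc_Im _))//; case: (f _) (f _) => [? ?] [? ?].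
Qed.

Lemma box_fun_slice0 l A M f i x s : box_fun l A M f -> i \in l ->
  A < `|s| -> f (upd i s x) = 0.
Proof. by move=> [_ _ _ f0] il As; apply: (f0 _ i) => //; rewrite updE eqxx. Qed.

Lemma pintL l A M N (a : R[i]) f g i : i \in l -> box_fun l A M f -> box_fun l A N g ->
  pint i (fun x => a * f x + g x) = fun x => a * pint i f x + pint i g x.
Proof.
move=> il nf ng; apply/funext => x; apply: (@cintegralL _ _ _ _ A).
- exact: box_fun_slice nf.
- exact: box_fun_slice ng.
- by move=> t; apply: box_fun_slice0 nf il.
- by move=> t; apply: box_fun_slice0 ng il.
Qed.

Lemma pint_bound l A M B f i x : i \in l -> box_fun l A M f ->
  (forall y, normc (f y) <= B) -> normc (pint i f x) <= 4 * A * B.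
Proof.
move=> il nf fB; apply: cintegral_bound => //.
- by case: nf.
- exact: box_fun_slice nf.
- by move=> t; apply: box_fun_slice0 nf il.
Qed.

(** In coordinate i the integral is constant; in any other coordinate the Lipschitz bound is applied
    under the integral sign. The factor [4 * A] is the one of [cintegral_bound]. *)
Lemma box_fun_pint l A M f i : i \notin l -> box_fun (i :: l) A M f ->
  box_fun l A (4 * A * M) (pint i f).
Proof.
move=> il nf; have [A0 M0 lip f0] := nf.
have ii : i \in i :: l by rewrite mem_head.
split=> //; first by rewrite !mulr_ge0.
- move=> x j a b; have [->|ji] := eqVneq j i.
    rewrite /pint; under eq_fun do rewrite upd_upd.
    under [X in _ - cintegral X]eq_fun do rewrite upd_upd.
    by rewrite subrr Normc.normc0 !mulr_ge0.
  have -> : pint i f (upd j a x) - pint i f (upd j b x) =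
      cintegral (fun s => (-1) * f (upd i s (upd j b x)) + f (upd i s (upd j a x))).
    rewrite (@cintegralL _ _ _ _ A) ?mulN1r 1?addrC//.
    - exact: box_fun_slice nf.
    - exact: box_fun_slice nf.
    - by move=> t; apply: box_fun_slice0 nf ii.
    - by move=> t; apply: box_fun_slice0 nf ii.
  rewrite -mulrA; apply: cintegral_bound => //.
  - by apply: ccontinuousL; exact: box_fun_slice nf.
  - by move=> t At; rewrite !(box_fun_slice0 _ nf ii At) mulr0 addr0.
  - by move=> t _; rewrite mulN1r addrC (updC t a x ji) (updC t b x ji).
- move=> x j jl Aj; rewrite /pint.
  have ji : j != i by apply: contraNneq il => <-.
  rewrite (_ : (fun s => _) = fun=> 0); last first.
    apply/funext => s; apply: (f0 _ j); first by rewrite in_cons jl orbT.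
    by rewrite updE (negbTE ji).
  exact: cintegral0.
Qed.

Lemma iintL l A M N (a : R[i]) f g : uniq l -> box_fun l A M f -> box_fun l A N g ->
  iint l (fun x => a * f x + g x) = fun x => a * iint l f x + iint l g x.
Proof.
elim: l M N f g => //= i l ih M N f g /andP[il ul] nf ng.
rewrite (pintL _ (mem_head i l) nf ng).
by apply: ih; [|exact: box_fun_pint il nf|exact: box_fun_pint il ng].
Qed.

Lemma iint_bound l A M B f x : uniq l -> box_fun l A M f ->
  (forall y, normc (f y) <= B) -> normc (iint l f x) <= (4 * A) ^+ size l * B.
Proof.
elim: l M B f => [|i l ih] M B f /=; first by rewrite expr0 mul1r.
move=> /andP[il ul] nf fB; rewrite exprSr -mulrA.
apply: ih (box_fun_pint il nf) _ => // y.
exact: pint_bound (mem_head i l) nf fB.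
Qed.

(** With an antiderivative F of k, both the integral of k(t + h) over [-B, B] and that of k over
    [-B + h, B + h] equal F(B + h) - F(-B + h). The choice B = |A| + |h| makes k(t + h) and k vanish
    outside these intervals. *)
Lemma cintegral_shift (f : R -> R[i]) (A h : R) : ccontinuous f ->
  (forall t, A < `|t| -> f t = 0) -> cintegral (fun t => f (t + h)) = cintegral f.
Proof.
have real (k : R -> R) : continuous k -> (forall t, A < `|t| -> k t = 0) ->
    \int[mu]_t k (t + h) = \int[mu]_t k t.
  move=> ck k0; have [F [_ dF]] := antiderivative ck.
  pose B := `|A| + `|h|.
  have B0 : 0 <= B by rewrite addr_ge0.
  have restr (a b : R) (g : R -> R) : (forall t, ~~ (a <= t <= b) -> g t = 0) -> g \_ `[a, b] = g.
    move=> g0; apply/funext => t; rewrite patchE; case: ifPn => //.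
    by rewrite notin_setE/= in_itv/= => /negP /g0.
  have hA := ler_norm A; have h1 := ler_norm h; have := ler_norm (- h); rewrite normrN => h2.
  have r1 : (fun t => k (t + h)) \_ `[- B, B] = fun t => k (t + h).
    apply: restr => t; rewrite negb_and -!ltNge /B => /orP[] H; apply: k0.
      by have := ler_norm (- (t + h)); rewrite normrN; lra.
    by have := ler_norm (t + h); lra.
  have r2 : k \_ `[- B + h, B + h] = k.
    apply: restr => t; rewrite negb_and -!ltNge /B => /orP[] H; apply: k0.
      by have := ler_norm (- t); rewrite normrN; lra.
    by have := ler_norm t; lra.
  rewrite -[in LHS]r1 -[in RHS]r2 -!Rintegral_mkcond.
  have dFh t : is_derive t (1 : R) (fun s => F (s + h)) (k (t + h)).
    have dl : is_derive t (1 : R) (fun s => s + h) 1.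
      rewrite (_ : (fun s => _) = id + cst h)//.
      by apply: is_derive_eq; rewrite addr0.
    have dF' := dF (t + h).
    rewrite (_ : (fun s => _) = F \o (fun s => s + h))//.
    by apply: is_derive_eq; rewrite mulr1.
  rewrite (Rintegral_derivative _ _ dFh); [|by lra|].
    by rewrite (Rintegral_derivative _ ck dF); [|lra].
  move=> t; apply: (@continuous_comp _ _ _ (fun s => s + h) k); last exact: ck.
  by move: t; apply: cont_add; [move=> ?; exact: cvg_id|exact: cst_continuous].
move=> [c1 c2] f0; congr Complex.
  by apply: (real (fun t => complex.Re (f t))) => // t /f0 ->.
by apply: (real (fun t => complex.Im (f t))) => // t /f0 ->.
Qed.

Definition shift_coord i (h : R) f x : R[i] := f (upd i (x 0 i + h) x).

Lemma box_fun_shift l A M f i h : box_fun l A M f ->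
  box_fun l (A + `|h|) M (shift_coord i h f).
Proof.
move=> [A0 M0 lip f0]; split=> //; first by rewrite addr_ge0.
- move=> x j a b; rewrite /shift_coord !updE.
  have [<-|ij] := eqVneq i j.
    by rewrite !upd_upd (le_trans (lip _ _ _ _))// opprD addrACA subrr addr0.
  by rewrite (updC _ a) 1?eq_sym// (updC _ b) 1?eq_sym//; exact: lip.
- move=> x j jl Aj; apply: (f0 _ j) => //; rewrite updE.
  case: eqP Aj => [->|_] Aj; last by have := normr_ge0 h; lra.
  have := ler_normB (x 0 i + h) h; rewrite addrK; lra.
Qed.

Lemma iint_shift l A M f i h : uniq l -> i \in l -> box_fun l A M f ->
  iint l (shift_coord i h f) = iint l f.
Proof.
elim: l M f => //= j l ih M f /andP[jl ul]; rewrite in_cons => /predU1P[->|il] nf.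
  congr iint; apply/funext => x; rewrite /pint.
  rewrite -[RHS](@cintegral_shift _ A h).
  - by congr cintegral; apply/funext => s; rewrite /shift_coord updE eqxx upd_upd.
  - exact: box_fun_slice nf.
  - by move=> t; apply: box_fun_slice0 nf (mem_head j l).
rewrite -(ih _ (pint j f) ul il (box_fun_pint jl nf)).
congr iint; apply/funext => x; rewrite /pint /shift_coord.
have ij : i != j by apply: contraNneq jl => <-.
by congr cintegral; apply/funext => s; rewrite updE (negbTE ij) (updC _ _ _ ij).
Qed.

(** Positivity is carried along at the one point x: the slice through x in direction i is
    nonnegative and takes the value f(x) > 0 at [x 0 i]. *)
Lemma iint_gt0 l A M f x : uniq l -> box_fun l A M f ->
  (forall y, complex.Im (f y) = 0 /\ 0 <= complex.Re (f y)) ->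
  0 < complex.Re (f x) -> 0 < complex.Re (iint l f x).
Proof.
elim: l M f => //= i l ih M f /andP[il ul] nf fge fx.
apply: (ih _ _ ul (box_fun_pint il nf)).
  move=> y; split=> /=; last by apply: Rintegral_ge0 => s _; exact: (fge _).2.
  rewrite (@eq_Rintegral _ _ _ _ setT (cst 0)); last by move=> s _; exact: (fge _).1.
  by have := @Rintegral_cst _ _ _ mu setT measurableT 0; rewrite mul0r.
apply: (@Rintegral_gt0 _ _ A (x 0 i)).
- by have [] := box_fun_slice i x nf.
- by move=> t At; rewrite (box_fun_slice0 x nf (mem_head i l) At).
- by move=> t; exact: (fge _).2.
- by rewrite upd_id.
Qed.

End IteratedIntegrals.

(** * Partial derivatives of test functions have iterated integral 0 *)

Section InvariantFunctional.
Context (R : realType) (d : nat).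
Local Notation V := 'rV[R]_d.
Implicit Types (x : V) (i j : 'I_d) (l : seq 'I_d).

Lemma ccontinuous_bounded (f : V -> R[i]) (K : set V) : compact K ->
  ccontinuous f -> exists M, 0 <= M /\ forall x, K x -> normc (f x) <= M.
Proof.
move=> cK cf; have [->|K0] := eqVneq K set0; first by exists 0.
have [c _ Hc] := EVT_max_rV ((set0P _).1 K0) cK
  (continuous_subspaceT (normc_continuous cf)).
exists (normc (f c)); split; first exact: normc_ge0.
by move=> x Kx; apply: Hc; rewrite inE.
Qed.

Lemma compact_box (K : set V) : compact K ->
  exists A : R, 0 <= A /\ forall x j, A < `|x 0 j| -> ~ K x.
Proof.
move=> cK.
have cj j : ccontinuous (fun x : V => (x 0 j)%:C%C : R[i]).
  by split; [exact: coord_continuous|exact: cst_continuous].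
have [M HM] := choice (fun j => ccontinuous_bounded cK (cj j)).
exists (\sum_j M j); split; first by apply: sumr_ge0 => j _; exact: (HM j).1.
move=> x j + Kx; rewrite ltNge => /negP; apply.
have [_ /(_ _ Kx)] := HM j; rewrite normc_real => /le_trans; apply.
by rewrite (bigD1 j)//= lerDl sumr_ge0// => k _; exact: (HM k).1.
Qed.

Lemma testfun_bounded (f : testfun R d) : exists M, 0 <= M /\ forall x, normc (f x) <= M.
Proof.
have [sf cK] := testfunP f.
have [M [M0 HM]] := ccontinuous_bounded cK (sf [::]).1.
exists M; split=> // x; have [fx|fx] := eqVneq (f x) 0; first by rewrite fx Normc.normc0.
by apply: HM; exact: subset_closure.
Qed.

Lemma testfun_box (f : testfun R d) : exists A : R, 0 <= A /\
  forall x j, A < `|x 0 j| -> f x = 0.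
Proof.
have [_ /compact_box[A [A0 HA]]] := testfunP f; exists A; split=> // x j Aj.
by apply: contrapT => /eqP fx; apply: (HA x j Aj); exact: subset_closure.
Qed.

(** First partial derivatives are bounded. Summing their bounds gives one constant for all
    directions, and the factor 2 pays for treating real and imaginary parts separately. *)
Lemma testfun_box_fun (f : testfun R d) (A : R) l : 0 <= A ->
  (forall x j, j \in l -> A < `|x 0 j| -> f x = 0) ->
  exists M, box_fun l A M f.
Proof.
move=> A0 f0.
have [M HM] := choice (fun i => testfun_bounded (tpartial i f)).
exists (2 * \sum_i M i); split=> //.
  by rewrite mulr_ge0// sumr_ge0// => i _; exact: (HM i).1.
move=> x i a b; rewrite (upd_sub i a b x).
have [Mi0 HMi] := HM i.
have MM : M i <= \sum_j M j.
  by rewrite (bigD1 i)//= lerDl sumr_ge0// => k _; exact: (HM k).1.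
have df := (testfun_smooth f [::]).2 i.
have h1 := @deriv_bound _ _ (fun y => complex.Re (f y)) _ (M i) (fun y => (df y).1)
  (fun y => le_trans (normc_Re (tpartial i f y)) (HMi y)) (upd i b x) (a - b).
have h2 := @deriv_bound _ _ (fun y => complex.Im (f y)) _ (M i) (fun y => (df y).2)
  (fun y => le_trans (normc_Im (tpartial i f y)) (HMi y)) (upd i b x) (a - b).
apply: le_trans (normc_le _) _.
have E (z w : R[i]) : complex.Re (z - w) = complex.Re z - complex.Re w /\
    complex.Im (z - w) = complex.Im z - complex.Im w by case: z w => [? ?] [? ?].
rewrite (E _ _).1 (E _ _).2; apply: le_trans (lerD h1 h2) _.
rewrite -mulrDl ler_wpM2r//; lra.
Qed.

Lemma box_fun_le l A B M (f : V -> R[i]) : A <= B -> box_fun l A M f -> box_fun l B M f.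
Proof.
move=> AB [A0 M0 lip f0]; split=> //; first exact: le_trans AB.
by move=> x j jl Bj; apply: (f0 _ _ jl); apply: le_lt_trans Bj.
Qed.

(** By the mean value theorem the quotient is a value of the partial derivative at distance less
    than h, and that derivative is Lipschitz. Real and imaginary parts may have different
    intermediate points, hence the functional [P] and the constant 2 C. *)
Lemma difference_quotient (g : testfun R d) i : exists C : R, 0 <= C /\
  forall h x, 0 < h ->
  normc ((h^-1)%:C%C * (shift_coord i h g x - g x) - tpartial i g x) <= C * h.
Proof.
have [A [A0 HA]] := testfun_box (tpartial i g).
have [C [_ C0 lip _]] := testfun_box_fun A0 (fun x j (_ : j \in enum 'I_d) => @HA x j).
exists (2 * C); split; first by rewrite mulr_ge0.
move=> h x h0.
have key (P : R[i] -> R) : (forall z w : R[i], P (z - w) = P z - P w) ->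
   (forall (a : R) z, P (a%:C%C * z) = a * P z) ->
   (forall z, `|P z| <= normc z) ->
   (forall y, is_derive y (delta_mx 0 i) (fun z => P (g z)) (P (tpartial i g y))) ->
   `|P ((h^-1)%:C%C * (shift_coord i h g x - g x) - tpartial i g x)| <= C * h.
  move=> PB PZ Pn dP.
  have dl (t : R) : is_derive t (1 : R) (fun s : R => P (g (x + s *: delta_mx 0 i)))
     (P (tpartial i g (x + t *: delta_mx 0 i))).
    have [d1 d2] := dP (x + t *: delta_mx 0 i).
    by rewrite -d2; exact: (derive_line d1).
  have [c] := MVT h0 (fun t _ => dl t) (continuous_subspaceT (is_derive_continuous dl)).
  rewrite in_itv/= => /andP[c0 ch] E.
  rewrite PB PZ PB /shift_coord upd_shift.
  move: E; rewrite scale0r addr0 subr0 => ->.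
  rewrite mulrCA mulVf ?gt_eqF// mulr1 -PB.
  have := lip x i (x 0 i + c) (x 0 i).
  rewrite upd_id upd_shift addrAC subrr add0r gtr0_norm// => H.
  apply: le_trans (Pn _) _; apply: le_trans H _.
  by rewrite ler_wpM2l// ltW.
have dg y := smooth_is_cderive i y (testfun_smooth g).
apply: le_trans (normc_le _) _; rewrite -mulrA mulr2n mulrDl mul1r lerD//.
  apply: key.
  - by move=> [? ?] [? ?].
  - by move=> a [b c]; rewrite cReM /= mul0r subr0.
  - exact: normc_Re.
  - by move=> y; exact: (dg y).1.
apply: key.
- by move=> [? ?] [? ?].
- by move=> a [b c]; rewrite cImM /= mul0r addr0.
- exact: normc_Im.
- by move=> y; exact: (dg y).2.
Qed.

(** Difference quotients of g have integral 0 by translation invariance and lie within C h of the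
    partial derivative, so the integral is at most a constant times h for every 0 < h <= 1. Boxes of
    size D + 1 leave room for the shift by h. *)
Lemma iint_partial (g : testfun R d) i x : iint (enum 'I_d) (tpartial i g) x = 0.
Proof.
have [A [A0 HA]] := testfun_box g; have [B [B0 HB]] := testfun_box (tpartial i g).
pose D := A + B + 1.
have D0 : 0 <= D by rewrite /D; lra.
have [M nM] : exists M, box_fun (enum 'I_d) D M g.
  by apply: testfun_box_fun => // y j _ h; apply: (HA _ j); rewrite /D in h; lra.
have [N nN] : exists N, box_fun (enum 'I_d) (D + 1) N (tpartial i g).
  apply: testfun_box_fun; first lra.
  by move=> y j _ h; apply: (HB _ j); rewrite /D in h; lra.
have [C [C0 HC]] := difference_quotient g i.
have ul := enum_uniq 'I_d.
pose I := @iint R d (enum 'I_d).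
have est (h : R) : 0 < h -> h <= 1 ->
    normc (I (tpartial i g) x) <= (4 * (D + 1)) ^+ size (enum 'I_d) * C * h.
  move=> h0 h1.
  have ng : box_fun (enum 'I_d) (D + 1) M g by apply: box_fun_le nM; lra.
  have ns : box_fun (enum 'I_d) (D + 1) M (shift_coord i h g).
    by apply: box_fun_le (box_fun_shift i h nM); rewrite gtr0_norm//; lra.
  pose q1 y := (-1) * g y + shift_coord i h g y.
  have comb (a : R[i]) N1 N2 f1 f2 : box_fun (enum 'I_d) (D + 1) N1 f1 ->
      box_fun (enum 'I_d) (D + 1) N2 f2 ->
      box_fun (enum 'I_d) (D + 1) (normc a * N1 + N2) (fun y => a * f1 y + f2 y).
    move=> [E0 N10 lip1 z1] [_ N20 lip2 z2]; split=> //.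
    - by rewrite addr_ge0// mulr_ge0// normc_ge0.
    - move=> y j s t; rewrite (_ : _ - _ = a * (f1 (upd j s y) - f1 (upd j t y)) +
        (f2 (upd j s y) - f2 (upd j t y))); last by ring.
      rewrite mulrDl -mulrA (le_trans (normcD _ _))// lerD// Normc.normcM.
      by rewrite ler_wpM2l// normc_ge0.
    - by move=> y j jl Dj; rewrite (z1 _ _ jl Dj) (z2 _ _ jl Dj) mulr0 addr0.
  have nq1 := comb (-1) _ _ _ _ ng ns.
  have Iq1 : I q1 = fun=> 0.
    rewrite /I (iintL _ ul ng ns) (iint_shift _ ul (mem_enum _ _) nM).
    by apply/funext => y; rewrite mulN1r addNr.
  (* The partial derivative minus the difference quotient: it has the same iterated integral as the
     former and is bounded by C h. *)
  pose q2 y := (- (h^-1)%:C%C) * q1 y + tpartial i g y.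
  have nq2 := comb (- (h^-1)%:C%C) _ _ _ _ nq1 nN.
  have Iq2 : I q2 = I (tpartial i g).
    by rewrite /I (iintL _ ul nq1 nN) -/I Iq1; apply/funext => y; rewrite mulr0 add0r.
  rewrite -Iq2 -mulrA; apply: (iint_bound _ ul nq2) => y.
  rewrite -normcN; apply: le_trans (HC h y h0).
  by rewrite le_eqVlt; apply/orP; left; apply/eqP; congr normc; rewrite /q2 /q1; ring.
apply: Normc.eq0_normc; apply/eqP; rewrite eq_le normc_ge0 andbT.
set E := (4 * (D + 1)) ^+ _ * C in est.
have E0 : 0 <= E by rewrite mulr_ge0// exprn_ge0// mulr_ge0//; lra.
rewrite leNgt; apply/negP => pos; set n := normc _ in pos est.
(* This h makes [E * h] smaller than n; the + 1 guards against E = 0. *)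
pose h := Num.min 1 (n / (2 * (E + 1))).
have h0 : 0 < h by rewrite lt_min ltr01 divr_gt0//; lra.
have h1 : h <= 1 by rewrite ge_min lexx.
have := est h h0 h1; apply/negP; rewrite -ltNge.
have hE : h <= n / (2 * (E + 1)) by rewrite ge_min lexx orbT.
apply: (@le_lt_trans _ _ (E * (n / (2 * (E + 1))))); first by rewrite ler_wpM2l.
rewrite mulrA ltr_pdivrMr; last lra.
nra.
Qed.

End InvariantFunctional.

(** * The exponential distribution *)

Section ExponentialDistribution.
Context (R : realType) (d : nat) (zeta : 'I_d -> R).
Local Notation V := 'rV[R]_d.
Implicit Types (x : V) (i j : 'I_d) (psi : testfun R d).

Definition expw x : R := expR (\sum_i zeta i * x 0 i).

Lemma is_derive_expw j x :
  is_derive x (delta_mx 0 j) expw (zeta j * expw x).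
Proof.
apply: is_derive_along.
rewrite (_ : (fun t : R => _) = expR \o (fun t : R => (fun t => zeta j * t) t + \sum_i zeta i * x 0 i)).
  have hl := is_derive_linear (zeta j) (0 : R).
  have hd : is_derive (0 : R) (1 : R) (fun t : R => zeta j * t + \sum_i zeta i * x 0 i) (zeta j).
    rewrite (_ : (fun t => _) = (fun t => zeta j * t) + cst (\sum_i zeta i * x 0 i))//.
    by apply: is_derive_eq; rewrite addr0.
  by apply: is_derive_eq; rewrite /expw mulr0 add0r mulrC.
apply/funext => t /=; congr expR.
rewrite (eq_bigr (fun k => zeta k * x 0 k + t * (zeta k *+ (k == j)))).
  rewrite big_split /= addrC; congr (_ + _).
  rewrite (bigD1 j)//= eqxx mulr1n big1 ?addr0 1?mulrC// => k /negbTE ->.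
  by rewrite mulr0n mulr0.
move=> k _; rewrite -upd_shift.
rewrite updE; case: eqP => [->|_]; first by rewrite mulr1n; ring.
by rewrite mulr0n mulr0 addr0.
Qed.

Lemma smooth_expw : smooth (fun x => (expw x)%:C%C).
Proof.
apply: (@smooth_span _ _ (fun f => exists c : R[i], f = c *: (fun x => (expw x)%:C%C))); last first.
  by apply: span_gen; exists 1; rewrite scale1r.
move=> _ [c ->].
have dE x j := is_cderive_real (is_derive_expw j x).
have cE : continuous expw.
  move=> x; apply: (@continuous_comp _ _ _ (fun y : V => \sum_i zeta i * y 0 i) expR); last exact: continuous_expR.
  move: x; elim: (index_enum _) => [|i s ih].
    rewrite (_ : (fun y => _) = cst 0); first exact: cst_continuous.
    by apply/funext => y; rewrite big_nil.
  rewrite (_ : (fun y => _) = fun y : V => zeta i * y 0 i + \sum_(j <- s) zeta j * y 0 j).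
    apply: cont_add => //; apply: cont_mul; [exact: cst_continuous|exact: coord_continuous].
  by apply/funext => y; rewrite big_cons.
split.
  rewrite -[_ *: _]addr0; apply: ccontinuousL; last exact: ccontinuous_cst.
  by split; [exact: cE|exact: cst_continuous].
move=> j; exists ((c * (zeta j)%:C%C) *: (fun x => (expw x)%:C%C)).
  by apply: span_gen; exists (c * (zeta j)%:C%C).
move=> x; apply: is_cderive_eq; first exact: is_cderiveZ (dE x j).
by rewrite rmorphM mulrA.
Qed.

Lemma weighted_subproof psi : test_pred (fun x => (expw x)%:C%C * psi x).
Proof.
have [sp cp] := testfunP psi; apply/asboolP; split.
  exact: smoothM smooth_expw sp.
apply: (compact_suppL cp) => x h.
suff -> : psi x = 0 by rewrite mulr0.
by apply: contrapT => /eqP px; apply: h; exact: subset_closure.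
Qed.

Definition weighted psi : testfun R d := TestFun (weighted_subproof psi).

Lemma weightedL a psi1 psi2 : weighted (a *: psi1 + psi2) = a *: weighted psi1 + weighted psi2.
Proof.
apply: testfun_eq => x; rewrite testfunLE -[LHS]/((expw x)%:C%C * (a * psi1 x + psi2 x)).
rewrite -[weighted psi1 x]/((expw x)%:C%C * psi1 x) -[weighted psi2 x]/((expw x)%:C%C * psi2 x).
ring.
Qed.

Lemma tpartial_weighted i psi :
  tpartial i (weighted psi) = (zeta i)%:C%C *: weighted psi + weighted (tpartial i psi).
Proof.
apply: testfun_eq => x.
have h := is_cderiveM (is_cderive_real (is_derive_expw i x))
                      (smooth_is_cderive i x (testfun_smooth psi)).
rewrite -[LHS]/(cderive (delta_mx 0 i) (fun x => (expw x)%:C%C * psi x) x).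
by rewrite (is_cderiveW h).2 rmorphM -mulrA.
Qed.

(** The integral of e^(zeta.x) psi(x) over R^d; evaluation at 0 turns the fully integrated function
    into a scalar. *)
Definition exp_pairing psi : R[i] := iint (enum 'I_d) (weighted psi) 0.

Lemma exp_distr_subproof : distr_pred exp_pairing.
Proof.
have ul := enum_uniq 'I_d.
apply/asboolP; split.
  move=> a f g; rewrite /exp_pairing weightedL.
  have [A [A0 HA]] := testfun_box (weighted f).
  have [B [B0 HB]] := testfun_box (weighted g).
  pose D := A + B.
  have D0 : 0 <= D by rewrite addr_ge0.
  have [M nM] : exists M, box_fun (enum 'I_d) D M (weighted f).
    by apply: testfun_box_fun => // y j _ h; apply: (HA _ j); rewrite /D in h; lra.
  have [N nN] : exists N, box_fun (enum 'I_d) D N (weighted g).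
    by apply: testfun_box_fun => // y j _ h; apply: (HB _ j); rewrite /D in h; lra.
  by have := iintL a ul nM nN => /(congr1 (fun k => k 0)).
move=> psi_ [[K cK K0] c0].
have [A [A0 HA]] := compact_box cK.
have [W [W0 HW]] := ccontinuous_bounded cK (smooth_expw [::]).1.
apply: (@small_cvg0 _ (fun n => exp_pairing (psi_ n)) ((4 * A) ^+ size (enum 'I_d) * W)).
  by rewrite mulr_ge0// exprn_ge0// mulr_ge0.
move=> eps eps0; apply: filterS (c0 [::] _ eps0) => n Hn.
have [M nM] : exists M, box_fun (enum 'I_d) A M (weighted (psi_ n)).
  apply: testfun_box_fun => // y j _ h.
  by rewrite -[LHS]/((expw y)%:C%C * psi_ n y) K0 ?mulr0//; exact: HA h.
rewrite -mulrA; apply: (iint_bound _ ul nM) => y.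
rewrite -[weighted _ y]/((expw y)%:C%C * psi_ n y).
have [Ky|Ky] := pselect (K y); last by rewrite (K0 n _ Ky) mulr0 Normc.normc0 mulr_ge0// ltW.
by rewrite Normc.normcM ler_pM ?normc_ge0//; [exact: HW|exact: Hn].
Qed.

Definition exp_distr : distr R d := Distr exp_distr_subproof.

(** The derivative of e^(zeta.x) psi in x_i is zeta_i e^(zeta.x) psi + e^(zeta.x) d psi/dx_i, and
    its integral is 0; the sign in [dpartial] does the rest. *)
Lemma dpartial_exp_distr i : dpartial i exp_distr = (zeta i)%:C%C *: exp_distr.
Proof.
apply: distr_eq => psi.
rewrite -[LHS]/(- exp_pairing (tpartial i psi)) -[RHS]/((zeta i)%:C%C * exp_distr psi).
have : iint (enum 'I_d) (tpartial i (weighted psi)) 0 = 0 by exact: iint_partial.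
have -> : iint (enum 'I_d) (tpartial i (weighted psi)) 0 =
    (zeta i)%:C%C * exp_distr psi + exp_distr (tpartial i psi); last first.
  by move/eqP; rewrite addr_eq0 => /eqP ->.
rewrite -distrL; congr iint; rewrite weightedL -tpartial_weighted.
by [].
Qed.

Lemma exp_distr_neq0 : exists psi, exp_distr psi != 0.
Proof.
have [b [beta [bE b0 bc _]]] := exists_bump (0 : V) (@ltr01 R).
exists beta; apply/eqP => E0.
have [A [A0 HA]] := testfun_box (weighted beta).
have [M nM] := testfun_box_fun A0 (fun x j (_ : j \in enum 'I_d) => @HA x j).
suff : 0 < complex.Re (iint (enum 'I_d) (weighted beta) 0).
  by rewrite -/(exp_pairing beta) -[exp_pairing _]/(exp_distr beta) E0 ltxx.
have E x : weighted beta x = (expw x * b x)%:C%C.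
  by rewrite -[LHS]/((expw x)%:C%C * beta x) bE rmorphM.
apply: (iint_gt0 (enum_uniq _) nM).
  by move=> y; rewrite E /=; split=> //; rewrite mulr_ge0// expR_ge0.
by rewrite E mulr_gt0// expR_gt0.
Qed.

Lemma dmonomial_exp k : dmonomial k exp_distr =
  (\prod_i (zeta i)%:C%C ^+ k i) *: exp_distr.
Proof.
rewrite /dmonomial -big_enum /=; elim: (enum 'I_d) => [|i s ih].
  by rewrite big_nil scale1r.
rewrite big_cons /= ih; elim: (k i) => [|n ih2] /=; first by rewrite expr0 mul1r.
rewrite ih2; have dpZ (a : R[i]) : dpartial i (a *: exp_distr) = a *: dpartial i exp_distr.
  have := dpartialL i a exp_distr 0; rewrite addr0 => ->.
  have -> : dpartial i (0 : distr R d) = 0; last by rewrite addr0.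
  by apply: distr_eq => f; rewrite -[LHS]/(- 0) oppr0.
rewrite dpZ dpartial_exp_distr scalerA; congr (_ *: _).
rewrite exprS; ring.
Qed.

Lemma dpolynomial_exp (a : mpoly d R[i]) : dpolynomial a exp_distr =
  meval (fun i => (zeta i)%:C%C) a *: exp_distr.
Proof.
rewrite /dpolynomial mevalE scaler_suml; apply: eq_bigr => k _.
by rewrite dmonomial_exp scalerA.
Qed.

End ExponentialDistribution.

(** * Non-vanishing points of polynomials *)

Lemma digits_inj (N d : nat) (f g : 'I_d -> nat) :
  (forall i, (f i < N)%N) -> (forall i, (g i < N)%N) ->
  (\sum_(i < d) f i * N ^ i)%N = (\sum_(i < d) g i * N ^ i)%N -> f =1 g.
Proof.
elim: d f g => [|d ih] f g fN gN; first by move=> _ [].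
have shift (h : 'I_d.+1 -> nat) : (\sum_(i < d.+1) h i * N ^ i =
    h ord0 + N * \sum_(i < d) h (lift ord0 i) * N ^ i)%N.
  rewrite big_ord_recl expn0 muln1 big_distrr /=; congr (_ + _)%N.
  by apply: eq_bigr => i _; rewrite /bump /= add1n expnS mulnCA.
rewrite !shift => E.
have N0 : (0 < N)%N by apply: leq_ltn_trans (fN ord0).
have E0 : f ord0 = g ord0.
  have := congr1 (fun k => (k %% N)%N) E.
  by rewrite /= !(mulnC N) !(addnC _ (_ * N)%N) !modnMDl !modn_small.
move: E; rewrite E0 => /addnI /eqP; rewrite eqn_pmul2l// => /eqP E1 i.
case: (unliftP ord0 i) => [j ->|->//].
by apply: (ih (f \o lift ord0) (g \o lift ord0)) => // k; [exact: fN|exact: gN].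
Qed.

(* Kronecker substitution X_i |-> X^(N^i): by uniqueness of base N digits,
   distinct monomials of a stay distinct. *)
Lemma mpoly_nonroot (F : numDomainType) (d : nat) (a : mpoly d F) : a != 0 ->
  exists v : 'I_d -> nat, meval (fun i => (v i)%:R) a != 0.
Proof.
move=> a0.
pose N := (\max_(m <- msupp a) mdeg m).+1.
have mN (m : multinom d) (i : 'I_d) : m \in msupp a -> (m i < N)%N.
  move=> ma; rewrite ltnS.
  apply: (@leq_trans (mdeg m)); last exact: (leq_bigmax_seq (F := fun m : multinom d => mdeg m) m ma).
  by rewrite mdegE (bigD1 i)//= leq_addr.
pose e (m : multinom d) := (\sum_(i < d) m i * N ^ i)%N.
pose Q : {poly F} := \sum_(m <- msupp a) mcoeff m a *: 'X^(e m).
have [m0 m0a] : exists m0, m0 \in msupp a.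
  case E : (msupp a) => [|m s]; last by exists m; rewrite mem_head.
  by move/eqP: E; rewrite msupp_eq0 (negbTE a0).
have Q0 : Q != 0.
  apply/eqP => /(congr1 (fun q : {poly F} => q`_(e m0))).
  rewrite coef0 /Q coef_sum (bigD1_seq m0)//= ?msupp_uniq// coefZ coefXn eqxx mulr1.
  rewrite big_seq_cond big1 ?addr0; first by apply/eqP; rewrite -mcoeff_msupp.
  move=> m /andP[ma mm0]; rewrite coefZ coefXn; case: eqP => [E|_]; last by rewrite mulr0.
  case/eqP: mm0; apply/mnmP => i.
  exact: (digits_inj (fun i => mN m i ma) (fun i => mN m0 i m0a) (esym E)).
have [k Qk] : exists k : nat, Q.[k%:R] != 0.
  apply: contrapT => H.
  (* The numbers 0, ..., size Q - 1 are distinct in F and exceed the possible number of roots of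
     Q. *)
  have r : all (root Q) [seq (k%:R : F) | k <- iota 0 (size Q)].
    apply/allP => _ /mapP[k _ ->]; apply/negPn/negP => h.
    by apply: H; exists k.
  have u : uniq [seq (k%:R : F) | k <- iota 0 (size Q)].
    by rewrite map_inj_uniq ?iota_uniq// => x y /eqP; rewrite eqr_nat => /eqP.
  by have := max_poly_roots Q0 r u; rewrite size_map size_iota ltnn.
exists (fun i => k ^ (N ^ i))%N; move: Qk; congr (_ != _).
rewrite mevalE /Q horner_sum; apply: eq_bigr => m _.
rewrite hornerZ hornerXn; congr (_ * _); rewrite /e expr_sum.
by apply: eq_bigr => i _; rewrite natrX mulnC exprM.
Qed.

(** * Operators of higher order *)

Section FundamentalSolution.
Context (R : realType).
Implicit Types (phi eta : testfun R 1) (q : {poly R[i]}).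

Definition pairing (v : R -> R[i]) phi : R[i] :=
  cintegral (fun t => phi (const_mx t) * v t).

(** The concatenation of 0 and v, with the convention of [concatenation] at t = 0. If v(0) <> 0 it
    jumps there, which produces the delta. *)
Definition half_line (v : R -> R[i]) (t : R) : R[i] := if t <= 0 then 0 else v t.

Lemma pairingL v (a : R[i]) phi eta : ccontinuous v ->
  pairing v (a *: phi + eta) = a * pairing v phi + pairing v eta.
Proof.
move=> cv.
have [A [A0 HA]] := testfun_line_supp phi; have [B [B0 HB]] := testfun_line_supp eta.
rewrite -(@cintegralL _ _ _ _ (Num.max A B)).
- by congr cintegral; apply/funext => t; rewrite testfunLE; ring.
- by apply: ccontinuousM => //; exact: testfun_line.
- by apply: ccontinuousM => //; exact: testfun_line.
- by move=> t; rewrite gt_max => /andP[/HA -> _]; rewrite mul0r.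
- by move=> t; rewrite gt_max => /andP[_ /HB ->]; rewrite mul0r.
Qed.

Lemma pairing0 v : ccontinuous v -> pairing v 0 = 0.
Proof.
move=> cv; have := pairingL (-1) 0 0 cv.
by rewrite scaleN1r oppr0 addr0 mulN1r addNr.
Qed.

Lemma pairingZ v (a : R[i]) phi : ccontinuous v ->
  pairing v (a *: phi) = a * pairing v phi.
Proof. by move=> cv; rewrite -[a *: phi]addr0 pairingL// pairing0// addr0. Qed.

Lemma cintegral_half_line (F f : R -> R[i]) (A : R) : 0 <= A -> ccontinuous f ->
  (forall t, is_cderive t (1 : R) F (f t)) -> (forall t, A < `|t| -> f t = 0) ->
  cintegral (half_line f) = F A - F 0.
Proof.
move=> A0 [c1 c2] dF f0.
have E (z w : R[i]) : z - w = Complex (complex.Re z - complex.Re w) (complex.Im z - complex.Im w).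
  by case: z w => [? ?] [? ?].
rewrite E; congr Complex.
  rewrite -(Rintegral_derivative_half A0 c1 (fun t => (dF t).1)).
    by apply: eq_Rintegral => t _; rewrite /half_line; case: ifP.
  by move=> t /f0 ->.
rewrite -(Rintegral_derivative_half A0 c2 (fun t => (dF t).2)).
  by apply: eq_Rintegral => t _; rewrite /half_line; case: ifP.
by move=> t /f0 ->.
Qed.

(** The transpose of d/dt. Accordingly [tpoly q] is the transpose of q(d/dt), and pairing v with
    [tpoly q phi] tests q(d/dt) v against phi. *)
Definition tneg phi : testfun R 1 := (-1) *: tpartial ord0 phi.

Lemma tnegL (a : R[i]) phi eta : tneg (a *: phi + eta) = a *: tneg phi + tneg eta.
Proof. by rewrite /tneg tpartialL scalerDr !scalerA mulrC. Qed.

(** Integration by parts for (d/dt - l) v = f. On the whole line there is no boundary term; on the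
    half-line the endpoint 0 leaves eta(0) v(0). *)
Lemma ode_pairing (l : R[i]) (v f : R -> R[i]) eta : ccontinuous f ->
  (forall t, is_cderive t (1 : R) v (l * v t + f t)) ->
  pairing v (tneg eta - l *: eta) = pairing f eta /\
  pairing (half_line v) (tneg eta - l *: eta) =
    eta (const_mx 0) * v 0 + pairing (half_line f) eta.
Proof.
move=> cf dv; have cv := is_cderive_continuous dv.
have dev t := is_cderiveM (testfun_line_derive eta t) (dv t).
pose g t := eta (const_mx t) * f t.
have cg : ccontinuous g by apply: ccontinuousM => //; exact: testfun_line.
have [F [F0 dF]] := cantiderivative cg.
pose h (t : R) : R[i] := (tneg eta - l *: eta) (const_mx t) * v t.
have ch : ccontinuous h by apply: ccontinuousM => //; exact: testfun_line.
(* An antiderivative of h: differentiating - eta v gives h - eta f, and F supplies the missing eta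
   f. *)
pose G t := (-1) * (eta (const_mx t) * v t) + F t.
have hE t : h t = (-1) * (tpartial ord0 eta (const_mx t) * v t +
    eta (const_mx t) * (l * v t + f t)) + g t.
  rewrite /h /tneg -[(_ - _ : testfun R 1) _]/((-1) * tpartial ord0 eta (const_mx t) - l * eta (const_mx t)).
  rewrite /g; ring.
have dG t : is_cderive t (1 : R) G (h t).
  rewrite hE; apply: is_cderiveD; last exact: dF.
  exact: is_cderiveZ (dev t).
have [A [A0 HA]] := testfun_line_supp eta; have [B [B0 HB]] := testfun_line_supp (tneg eta).
pose D := A + B + 1.
have D0 : 0 <= D by rewrite /D; lra.
have eta0 t : D <= `|t| -> eta (const_mx t) = 0 by move=> h0; apply: HA; rewrite /D in h0; lra.
have h0 t : D < `|t| -> h t = 0.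
  move=> Dt; rewrite /h -[(_ - _ : testfun R 1) _]/(tneg eta (const_mx t) - l * eta (const_mx t)).
  by rewrite (HB t) ?(HA t) ?mulr0 ?subr0 ?mul0r//; rewrite /D in Dt; lra.
have g0 t : D < `|t| -> g t = 0 by move=> /ltW /eta0; rewrite /g => ->; rewrite mul0r.
split.
  rewrite /pairing -/h -/g.
  pose k t := tpartial ord0 eta (const_mx t) * v t + eta (const_mx t) * (l * v t + f t).
  have ck : ccontinuous k.
    rewrite (_ : k = fun t => (-1) * h t + g t).
      exact: ccontinuousL.
    by apply/funext => t; rewrite hE /k; ring.
  have k0 t : D < `|t| -> k t = 0.
    move=> Dt; have := hE t; rewrite (h0 t Dt) (g0 t Dt) addr0 mulN1r -/(k t).
    by move/esym/eqP; rewrite oppr_eq0 => /eqP.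
  have -> : h = fun t => (-1) * k t + g t by apply/funext => t; rewrite hE.
  rewrite (cintegralL _ ck cg k0 g0).
  rewrite (@cintegral_derivative _ (fun t => eta (const_mx t) * v t) k D) ?mulr0 ?add0r//.
  by move=> t /ltW /eta0 ->; rewrite mul0r.
have halfM w phi : (fun t => phi (const_mx t) * half_line w t) =
    half_line (fun t => phi (const_mx t) * w t).
  by apply/funext => t; rewrite /half_line; case: ifP; rewrite ?mulr0.
rewrite /pairing !halfM -/h -/g.
rewrite (cintegral_half_line D0 ch dG h0) (cintegral_half_line D0 cg dF g0) /G.
rewrite eta0 ?ger0_norm// F0; ring.
Qed.

Definition tpoly q phi : testfun R 1 := \sum_(k < size q) q`_k *: iter k tneg phi.

Lemma tpolyE q phi N : (size q <= N)%N ->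
  tpoly q phi = \sum_(k < N) q`_k *: iter k tneg phi.
Proof.
move=> qN; rewrite /tpoly -!(big_mkord xpredT (fun k => q`_k *: iter k tneg phi)).
rewrite [RHS](big_cat_nat (n := size q))//= [X in _ = _ + X]big1_seq ?addr0//.
move=> k; rewrite mem_index_iota => /andP[_ /andP[qk _]].
by rewrite nth_default// scale0r.
Qed.

Lemma tpoly1 phi : tpoly 1 phi = phi.
Proof. by rewrite /tpoly size_poly1 big_ord_recl big_ord0 addr0 coef1 scale1r. Qed.

Lemma tpolyZ (a : R[i]) q phi : tpoly (a *: q) phi = a *: tpoly q phi.
Proof.
rewrite (@tpolyE (a *: q) _ (size q)) ?size_scale_leq// /tpoly scaler_sumr.
by apply: eq_bigr => k _; rewrite coefZ scalerA.
Qed.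

Lemma tneg0 : tneg 0 = 0.
Proof. by have := tnegL (-1) 0 0; rewrite !scaleN1r oppr0 !addr0 addNr. Qed.

Lemma tnegZ a phi : tneg (a *: phi) = a *: tneg phi.
Proof. by rewrite -[a *: phi]addr0 tnegL tneg0 addr0. Qed.

Lemma tneg_sum N (F : nat -> testfun R 1) :
  tneg (\sum_(k < N) F k) = \sum_(k < N) tneg (F k).
Proof.
elim: N => [|N ih]; first by rewrite !big_ord0 tneg0.
by rewrite !big_ord_recr /= -[X in tneg (X + _)]scale1r tnegL scale1r ih.
Qed.

Lemma tpoly_XsubC (l : R[i]) q phi :
  tpoly (('X - l%:P) * q) phi = tneg (tpoly q phi) - l *: tpoly q phi.
Proof.
have sq : (size (('X - l%:P) * q)%R <= (size q).+1)%N.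
  by rewrite (leq_trans (size_polyMleq _ _))// size_XsubC.
rewrite (tpolyE _ sq).
have E k : (('X - l%:P) * q)`_k = (if k == 0%N then 0 else q`_k.-1) - l * q`_k.
  by rewrite mulrBl coefB coefXM coefCM.
under eq_bigr => k _ do rewrite E scalerBl -scalerA.
rewrite sumrB -scaler_sumr -(tpolyE _ (leqnSn _)); congr (_ - _).
rewrite big_ord_recl /= scale0r add0r /tpoly (tneg_sum _ (fun k => q`_k *: iter k tneg phi)).
by apply: eq_bigr => k _; rewrite tnegZ.
Qed.

Lemma pairing_vanish (v : R -> R[i]) phi : (forall t, v t = 0) -> pairing v phi = 0.
Proof.
move=> v0; rewrite /pairing (_ : (fun t => _) = fun=> 0); first exact: cintegral0.
by apply/funext => t; rewrite v0 mulr0.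
Qed.

(* Built root by root: v solves v' = z v + f with v(0) = 0, where f belongs to
   the remaining roots, so that (d/dt - z) turns half_line v into half_line f;
   for the last root f = 0 and v(0) = 1, which leaves delta_0. *)
Lemma fundamental_solution (rs : seq R[i]) : rs != [::] ->
  exists v v', [/\ ccontinuous v', forall t, is_cderive t (1 : R) v (v' t),
    (1 < size rs)%N -> v 0 = 0,
    forall phi, pairing v (tpoly (\prod_(z <- rs) ('X - z%:P)) phi) = 0 &
    forall phi, pairing (half_line v) (tpoly (\prod_(z <- rs) ('X - z%:P)) phi)
      = phi (const_mx 0)].
Proof.
have C1 (z : R[i]) (v f : R -> R[i]) : ccontinuous f ->
    (forall t, is_cderive t (1 : R) v (z * v t + f t)) -> ccontinuous (fun t : R => z * v t + f t).
  by move=> cf dv; apply: ccontinuousL => //; exact: is_cderive_continuous dv.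
elim: rs => // z [|z' rs] ih _.
  have c0 : ccontinuous (fun _ : R => 0 : R[i]) by exact: ccontinuous_cst.
  have [v [v0 dv]] := linear_ode z 1 c0.
  exists v, (fun t => z * v t + 0); split => //.
  - exact: C1 c0 dv.
  - move=> phi; rewrite big_cons big_nil tpoly_XsubC tpoly1.
    by rewrite (ode_pairing phi c0 dv).1 pairing_vanish.
  - move=> phi; rewrite big_cons big_nil tpoly_XsubC tpoly1.
    rewrite (ode_pairing phi c0 dv).2 v0 mulr1 pairing_vanish ?addr0//.
    by move=> t; rewrite /half_line; case: ifP.
have [f [f' [cf' df f0 pf hf]]] := ih isT.
have cf := is_cderive_continuous df.
have [v [v0 dv]] := linear_ode z 0 cf.
exists v, (fun t => z * v t + f t); split => //.
- exact: C1 cf dv.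
- move=> phi; rewrite big_cons tpoly_XsubC.
  by rewrite (ode_pairing _ cf dv).1 pf.
- move=> phi; rewrite big_cons tpoly_XsubC.
  by rewrite (ode_pairing _ cf dv).2 v0 mulr0 add0r hf.
Qed.

Lemma iter_tneg k phi : iter k tneg phi = (-1) ^+ k *: iter k (@tpartial R 1 ord0) phi.
Proof.
elim: k => [|k ih]; first by rewrite expr0 scale1r.
by rewrite iterS ih tnegZ /tneg scalerA exprSr.
Qed.

End FundamentalSolution.

(** * Separation of variables and the failure of concatenability *)

Section HigherOrder.
Context (R : realType) (d : nat).

Lemma dpolynomialZ (a : mpoly d R[i]) (c : R[i]) (T : distr R d) :
  dpolynomial a (c *: T) = c *: dpolynomial a T.
Proof.
have a0 : dpolynomial a (0 : distr R d) = 0.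
  by have := dpolynomialL a (-1) 0 (0 : distr R d); rewrite !scaleN1r oppr0 !addr0 addNr.
by rewrite -[c *: T]addr0 dpolynomialL a0 addr0.
Qed.

(** Each a_k(d/dx) multiplies E by a_k(zeta), so only q(d/dt) remains. Only continuity of v is
    assumed, since [half_line v] need not be C^1. *)
Lemma Dop_separated (zeta : 'I_d -> R) (p : {poly mpoly d R[i]}) (v : R -> R[i])
    (u : R -> distr R d) (cu : dcontinuous u) phi psi :
  let q := map_poly (meval (fun i => (zeta i)%:C%C)) p in
  size q = size p -> ccontinuous v -> (forall t, u t = v t *: exp_distr zeta) ->
  Dop p (regular cu) phi psi = pairing v (tpoly q phi) * exp_distr zeta psi.
Proof.
move=> q sq cv uE; rewrite DopE /tpoly sq.
have rE eta : regular cu eta = pairing v eta *: exp_distr zeta.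
  apply: distr_eq => psi1; rewrite regularE.
  rewrite -[RHS]/(pairing v eta * exp_distr zeta psi1).
  have [A [A0 HA]] := testfun_line_supp eta.
  have c0 : ccontinuous (fun t => eta (const_mx t) * v t).
    by apply: ccontinuousM => //; exact: testfun_line.
  have v0 t : A < `|t| -> eta (const_mx t) * v t = 0 by move=> /HA ->; rewrite mul0r.
  rewrite (_ : (fun t => _) = fun t => (exp_distr zeta psi1 - 1) * (eta (const_mx t) * v t)
     + eta (const_mx t) * v t).
    by rewrite (cintegralL _ c0 c0 v0 v0) /pairing; ring.
  by apply/funext => t; rewrite uE -[(_ *: _ : distr R d) _]/(v t * exp_distr zeta psi1); ring.
elim: (size p) => [|n ih]; first by rewrite !big_ord0 pairing0// mul0r.
rewrite !big_ord_recr /= ih -[X in pairing v (X + _)]scale1r pairingL// mul1r mulrDl.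
congr (_ + _).
rewrite -[Distr _]/(regular cu (iter n (@tpartial R 1 ord0) phi)).
rewrite -[exp_pairing _ _]/(exp_distr zeta psi) rE scalerA dpolynomialZ dpolynomial_exp scalerA iter_tneg !pairingZ//.
rewrite coef_map_id0 ?meval0//.
set c := meval _ _.
rewrite -[LHS]/((-1) ^+ n * pairing v (iter n (@tpartial R 1 ord0) phi) * c * exp_distr zeta psi).
ring.
Qed.

Lemma not_concatenable (p : {poly mpoly d R[i]}) (n : nat) :
  size p = n.+1 -> (1 < n)%N -> ~ concatenable (solution_set p).
Proof.
move=> sp n1 conc.
have lp0 : lead_coef p != 0 by rewrite lead_coef_eq0 -size_poly_eq0 sp.
have [w wE] := mpoly_nonroot lp0.
pose zeta i : R := (w i)%:R.
have {}wE : meval (fun i => (zeta i)%:C%C) (lead_coef p) != 0.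
  move: wE; congr (_ != _); apply: meval_eq => i.
  by rewrite /zeta rmorph_nat.
pose q := map_poly (meval (fun i => (zeta i)%:C%C)) p.
(* The leading coefficient survives evaluation at zeta, so q has exactly n roots counted with
   multiplicity. *)
have sq : size q = size p by rewrite /q size_map_poly_id0.
have [rs qE] := closed_field_poly_normal q.
have lq : lead_coef q != 0 by rewrite lead_coef_eq0 -size_poly_eq0 sq sp.
have srs : size rs = n.
  by apply/eqP; rewrite -eqSS -sp -sq qE size_scale// size_prod_XsubC.
have [|v [v' [cv' dv v0 pv hv]]] := @fundamental_solution R rs.
  by rewrite -size_eq0 srs -lt0n ltnW.
have {}v0 : v 0 = 0 by apply: v0; rewrite srs.
have cv := is_cderive_continuous dv.
have [psi Epsi] := exp_distr_neq0 zeta.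
have dE (x : R -> R[i]) t psi1 : (x t *: exp_distr zeta) psi1 = x t * exp_distr zeta psi1 by [].
have sol (x x' : R -> R[i]) : ccontinuous x' -> (forall t, is_cderive t (1 : R) x (x' t)) ->
    (forall phi, pairing x (tpoly (\prod_(z <- rs) ('X - z%:P)) phi) = 0) ->
    solution_set p (fun t => x t *: exp_distr zeta) /\ dC1 (fun t => x t *: exp_distr zeta).
  move=> cx' dx px; have cx := is_cderive_continuous dx.
  have cu : dcontinuous (fun t => x t *: exp_distr zeta).
    by move=> psi1; apply: ccontinuousM => //; exact: ccontinuous_cst.
  split.
    exists cu; apply/vdistr_eq0 => phi psi1.
    rewrite (Dop_separated cu phi psi1 sq cx (fun=> erefl)) -/q qE tpolyZ.
    by rewrite pairingZ// px mulr0 mul0r.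
  move=> psi1.
  have dxE t : is_cderive t (1 : R) (fun s => (x s *: exp_distr zeta) psi1)
      (x' t * exp_distr zeta psi1).
    apply: is_cderive_eq; first exact: is_cderiveM (dx t) (is_cderive_cst _ _ _).
    by rewrite mulr0 addr0.
  split; first by move=> t; have [] := is_cderiveW (dxE t).
  rewrite (_ : cderive _ _ = fun t => x' t * exp_distr zeta psi1).
    by apply: ccontinuousM => //; exact: ccontinuous_cst.
  by apply/funext => t; have [] := is_cderiveW (dxE t).
have c0 : ccontinuous (fun _ : R => 0 : R[i]) by exact: ccontinuous_cst.
have [S1 C1] := sol (fun=> 0) (fun=> 0) c0 (fun t => is_cderive_cst _ _ _)
  (fun phi => pairing_vanish _ (fun=> erefl)).
have [S2 C2] := sol v v' cv' dv pv.
have u0 : 0 *: exp_distr zeta = v 0 *: exp_distr zeta by rewrite v0.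
have [cu Su] := conc _ _ S1 C1 S2 C2 u0.
have ch : ccontinuous (half_line v) by apply: ccontinuous_glue => //; rewrite v0.
have [b [beta [bE _ bc _]]] := exists_bump (const_mx 0 : 'rV[R]_1) (@ltr01 R).
have /vdistr_eq0/(_ beta psi) := Su.
have uE t : concatenation (fun=> 0 *: exp_distr zeta) (fun t => v t *: exp_distr zeta) t =
    half_line v t *: exp_distr zeta.
  by rewrite /concatenation /half_line; case: ifP.
rewrite (Dop_separated cu beta psi sq ch uE) -/q qE tpolyZ.
(* The pairing is [lead_coef q] times beta(0) times E(psi), a product of three nonzero factors. *)
rewrite pairingZ// hv bE => /eqP; rewrite !mulf_eq0 (negbTE lq) (negbTE Epsi) orbF /=.
by rewrite eq_complex /= gt_eqF.
Qed.

End HigherOrder.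

Theorem theorem4p1 (R : realType) (d : nat) (hd : (1 <= d)%N)
  (p : {poly mpoly d R[i]}) (n : nat) (hp : size p = n.+1) (hn : (1 <= n)%N) :
  concatenable (solution_set p) <-> n = 1%N.
Proof.
split=> [conc|n1]; last by apply: concatenable_first_order; rewrite hp n1.
apply/eqP; rewrite eqn_leq hn andbT leqNgt; apply/negP => n1.
exact: not_concatenable hp n1 conc.
Qed.
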